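(* Let $\{\mu_t\}_{t\ge0}$ be a weakly continuous boolean convolution semigroup with $\mu_0=\delta_0$, and let $\gamma\in\mathbb{R}$, $\tau$ positive finite be such that $K_{\mu_1}(z)=\gamma-\int_{\mathbb{R}}\frac{1+xz}{x-z}\,d\tau(x)$. The following are equivalent: (1) there exists $t_0>0$ such that $\operatorname{supp}\mu_{t_0}\subset[0,\infty)$; (2) $\operatorname{supp}\mu_t\subset[0,\infty)$ for all $0\le t<\infty$; (3) $\operatorname{supp}\tau\subset[0,\infty)$, $\tau(\{0\})=0$, $\int_0^\infty\frac1x\,d\tau(x)<\infty$ and $\gamma\ge\int_0^\infty\frac1x\,d\tau(x)$. In contrast, for free convolution semigroups condition (1) does not imply condition (2): there exists a weakly continuous free convolution semigroup $\{\mu_t\}_{t\ge0}$ with $\mu_0=\delta_0$ such that $\operatorname{supp}\mu_{t_0}\subset[0,\infty)$ for some $t_0>0$ but $\operatorname{supp}\mu_t\not\subset[0,\infty)$ for some $t>0$.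
   Context: For a probability measure $\mu$ on $\mathbb{R}$, $G_\mu(z)=\int\frac{1}{z-x}d\mu(x)$ on $\mathbb{C}^+$, $H_\mu=1/G_\mu$, and $K_\mu(z):=z-H_\mu(z)$, which has a unique representation $\gamma-\int\frac{1+xz}{x-z}d\tau(x)$. The boolean convolution $\mu\uplus\nu$ is characterized by $K_{\mu\uplus\nu}=K_\mu+K_\nu$. The Voiculescu transform $\phi_\mu(z):=H_\mu^{-1}(z)-z$ is defined on a region $\{|\operatorname{Re}z|<\eta|\operatorname{Im}z|,\ |\operatorname{Im}z|>M\}$ where $H_\mu$ has an analytic right inverse, and the free convolution $\mu\boxplus\nu$ is characterized by $\phi_{\mu\boxplus\nu}=\phi_\mu+\phi_\nu$. A weakly continuous boolean (resp. free) convolution semigroup is a weakly continuous family $\{\mu_t\}_{t\ge0}$ of probability measures with $\mu_s\uplus\mu_t=\mu_{s+t}$ (resp. $\mu_s\boxplus\mu_t=\mu_{s+t}$). *)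

(* Defs.v *)
From HB Require Import structures.
From mathcomp Require Import all_boot all_order all_algebra.
From mathcomp Require Import all_classical all_reals all_analysis.
From mathcomp Require Export complex.
Import Order.TTheory GRing.Theory Num.Theory.
Import numFieldNormedType.Exports.
Set Implicit Arguments.
Unset Strict Implicit.
Unset Printing Implicit Defensive.
Local Open Scope ring_scope.
Local Open Scope complex_scope.
Local Open Scope classical_set_scope.

Section Defs.
Context {R : realType}.

Definition cabs (z : R[i]) : R :=
  Num.sqrt (complex.Re z ^+ 2 + complex.Im z ^+ 2).

Definition cint (mu : {measure set R -> \bar R}) (f : R -> R[i]) : R[i] :=
  (Rintegral mu setT (fun x => complex.Re (f x)))%:C
  + 'i * (Rintegral mu setT (fun x => complex.Im (f x)))%:C.

Definition cauchyG (mu : {measure set R -> \bar R}) (z : R[i]) : R[i] :=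
  cint mu (fun x => (z - x%:C)^-1).

Definition Hfun (mu : {measure set R -> \bar R}) (z : R[i]) : R[i] :=
  (cauchyG mu z)^-1.

Definition Kfun (mu : {measure set R -> \bar R}) (z : R[i]) : R[i] :=
  z - Hfun mu z.

Definition is_boolean_conv (mu nu rho : {measure set R -> \bar R}) : Prop :=
  forall z : R[i], 0 < complex.Im z -> Kfun rho z = Kfun mu z + Kfun nu z.

Definition cone (eta M : R) : set R[i] :=
  [set z | `|complex.Re z| < eta * complex.Im z /\ M < complex.Im z].

Definition holomorphic_on (D : set R[i]) (F : R[i] -> R[i]) : Prop :=
  forall z0, D z0 -> exists l : R[i], forall e : R, 0 < e ->
    exists d : R, 0 < d /\ forall h : R[i], h != 0 -> cabs h < d ->
      cabs ((F (z0 + h) - F z0) / h - l) < e.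

Definition H_right_inverse (mu : {measure set R -> \bar R}) (eta M : R)
    (F : R[i] -> R[i]) : Prop :=
  [/\ 0 < eta, 0 < M, holomorphic_on (cone eta M) F,
      (forall z, cone eta M z -> 0 < complex.Im (F z) /\ Hfun mu (F z) = z) &
      (forall e : R, 0 < e -> exists N : R, forall z, cone eta M z ->
          N < cabs z -> cabs ((F z - z) / z) < e)].

(* rho = mu (free convolution) nu, characterized by phi_rho = phi_mu + phi_nu,
   phi(z) = H^{-1}(z) - z, on a common region Gamma_{eta,M} *)
Definition is_free_conv (mu nu rho : {measure set R -> \bar R}) : Prop :=
  exists (eta M : R) (F1 F2 F3 : R[i] -> R[i]),
    [/\ H_right_inverse mu eta M F1, H_right_inverse nu eta M F2,
        H_right_inverse rho eta M F3 &
        forall z, cone eta M z -> F3 z - z = (F1 z - z) + (F2 z - z)].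

Definition weakly_continuous (mu : R -> probability R R) : Prop :=
  forall f : R -> R, continuous f -> (exists C : R, forall x, `|f x| <= C) ->
  forall t0 : R, 0 <= t0 -> forall e : R, 0 < e -> exists d : R, 0 < d /\
    forall t : R, 0 <= t -> `|t - t0| < d ->
      `|Rintegral (mu t) setT f - Rintegral (mu t0) setT f| < e.

Definition boolean_semigroup (mu : R -> probability R R) : Prop :=
  weakly_continuous mu /\
  forall s t : R, 0 <= s -> 0 <= t -> is_boolean_conv (mu s) (mu t) (mu (s + t)).

Definition free_semigroup (mu : R -> probability R R) : Prop :=
  weakly_continuous mu /\
  forall s t : R, 0 <= s -> 0 <= t -> is_free_conv (mu s) (mu t) (mu (s + t)).

Definition supp (mu : {measure set R -> \bar R}) : set R :=
  [set x | forall r : R, 0 < r -> (0 < mu (ball x r))%E].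

End Defs.

(* Main.v *)
(* Write z = a + ib. Everything on the boolean side comes from real integrals
against q(x) = |z - x|^-2: with Q the integral of q and U that of (a - x) q, one
has G = U - ibQ, and for a probability measure the variance inequality
|G|^2 <= Q. A measure is null on every compact interval over which Q stays
bounded as b -> 0 (cover the interval by 1/b balls of mass O(b^2)); this replaces
Stieltjes inversion.

K is additive along the semigroup and bounded near time 0, so K_t = t K_1.
(1) => (3): if mu_t lives on [0, oo), then U <= aQ, and with |G|^2 <= Q this gives
Re H <= Re z, i.e. Re K >= 0, in the left half-plane. Also Im H = O(b) there, so
tau has no mass on the negative half-line, and Re K(-s + is) >= 0 bounds the
integral of 1/(x + 2s) by gamma + s tau(R); let s -> 0.
(3) => (2): Re ((1 + xz)/(x - z)) <= 1/x gives Re K >= 0, hence Re H <= a < 0,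
while Im H = O(b); so Im G = O(b), uniformly on compact sets.

The free counterexample is the semicircle law of mean 2t and variance t, the law
of 2t + 2 sqrt(t) cos x for x of density (2/pi) sin^2 x on [0, pi]; its H has
right inverse z + 2t + t/z. It lives on [0, 4] at t = 1, and at t = 1/16 it would
violate Re H <= Re z if it lived on [0, oo). *)
Require Import Defs.
From HB Require Import structures.
From mathcomp Require Import all_boot all_order all_algebra.
From mathcomp Require Import all_classical all_reals all_analysis.
From mathcomp Require Import measurable_realfun complex ring lra.
Import Order.TTheory GRing.Theory Num.Theory.
Import numFieldNormedType.Exports.
Local Open Scope ring_scope.
Local Open Scope complex_scope.
Local Open Scope classical_set_scope.
Set Implicit Arguments.
Unset Strict Implicit.

(** * Boolean semigroups *)

Section cauchy_transform.
Context {R : realType}.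
Implicit Types (m : {finite_measure set R -> \bar R}) (mu : probability R R).
Implicit Types a b x y : R.

Lemma bounded_integrable d (T : measurableType d)
    (m : {finite_measure set T -> \bar R}) (f : T -> R) (C : R) :
  measurable_fun setT f ->
  (forall x : T, `|f x| <= C) -> m.-integrable setT (EFin \o f).
Proof.
move=> mf fC; apply: measurable_bounded_integrable => //.
  by rewrite -ge0_fin_numE// fin_num_measure.
exists C; split; first by rewrite num_real.
by move=> y Cy x _ /=; rewrite (le_trans (fC x))// ltW.
Qed.

Lemma integrableZlR m c (f : R -> R) : m.-integrable setT (EFin \o f) ->
  m.-integrable setT (EFin \o (fun x => c * f x)).
Proof.
move=> If; have -> : EFin \o (fun x => c * f x) = (fun x => c%:E * (EFin \o f) x)%E.
  by [].
exact: integrableZl.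
Qed.

Lemma integrableDR m (f g : R -> R) : m.-integrable setT (EFin \o f) ->
  m.-integrable setT (EFin \o g) ->
  m.-integrable setT (EFin \o (fun x => f x + g x)).
Proof.
by move=> If Ig; exact: (integrableD measurableT If Ig).
Qed.

Lemma integrable_cstR m c : m.-integrable setT (EFin \o (fun _ : R => c)).
Proof. by apply: (@bounded_integrable _ _ _ _ `|c|) => //; exact: measurable_cst. Qed.

(** Integrals do not see null sets. With [N] a negative half-line, inequalities between kernels need
    checking only on the rest of the line. *)
Lemma le_Rintegral_null m (N : set R) (f g : R -> R) :
  measurable N -> m N = 0%E ->
  m.-integrable setT (EFin \o f) -> m.-integrable setT (EFin \o g) ->
  (forall x, ~ N x -> f x <= g x) ->
  Rintegral m setT f <= Rintegral m setT g.
Proof.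
move=> mN N0 If Ig fg.
have E h : m.-integrable setT (EFin \o h) ->
    Rintegral m setT h = Rintegral m (setT `\` N) h.
  by move=> Ih; rewrite /Rintegral (negligible_integral mN).
rewrite !E//; have mD : measurable (setT `\` N) by exact: measurableD.
apply: le_Rintegral => //; try exact: (integrableS measurableT).
by move=> x [_ /fg].
Qed.

(** If the integral vanished, the integrand would be zero almost everywhere; being positive
    everywhere, it would make the whole space null. *)
Lemma Rintegral_gt0 m (f : R -> R) : (0 < m setT)%E ->
  m.-integrable setT (EFin \o f) -> (forall x, 0 < f x) ->
  0 < Rintegral m setT f.
Proof.
move=> m0 If f0; rewrite lt_neqAle Rintegral_ge0 ?andbT//; last first.
  by move=> x _; exact: ltW.
apply: contraTneq m0 => I0; rewrite -leNgt.
have fm := measurable_int _ If.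
have /(ae_eq_integral_abs m measurableT fm) : (\int[m]_x `|(EFin \o f) x| = 0)%E.
  under eq_integral do rewrite /= ger0_norm ?ltW//.
  by rewrite -(fineK (integrable_fin_num measurableT If)) -[fine _]I0.
move=> [N [mN N0 fN]]; rewrite -N0 le_measure ?inE// => x _; apply: fN => /(_ I).
by move=> -[] /eqP; rewrite gt_eqF.
Qed.

(** With z = a + ib this is the Poisson kernel up to the factor b / pi; the real and imaginary parts
    of 1 / (z - x) are (a - x) and -b times it. *)
Definition pker (a b x : R) : R := ((a - x) ^+ 2 + b ^+ 2)^-1.

Lemma pker_den a b x : 0 < b -> 0 < (a - x) ^+ 2 + b ^+ 2.
Proof. by move=> b0; rewrite ltr_wpDl ?sqr_ge0// exprn_gt0. Qed.

Lemma pker_gt0 a b x : 0 < b -> 0 < pker a b x.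
Proof. by move=> b0; rewrite invr_gt0 pker_den. Qed.

Lemma pker_le a b x : 0 < b -> pker a b x <= (b ^+ 2)^-1.
Proof.
by move=> b0; rewrite lef_pV2 ?posrE ?exprn_gt0 ?pker_den// lerDr sqr_ge0.
Qed.

Lemma pker1_le a b x : 0 < b -> `|(a - x) * pker a b x| <= b^-1.
Proof.
move=> b0; rewrite normrM (gtr0_norm (pker_gt0 _ _ b0)).
rewrite ler_pdivrMr ?pker_den// mulrC ler_pdivlMr//.
rewrite -[(a - x) ^+ 2]real_normK ?num_real//.
have := normr_ge0 (a - x); nra.
Qed.

Lemma continuous_pker a b : 0 < b -> continuous (pker a b).
Proof.
move=> b0 x; apply: cvgV; first by rewrite gt_eqF ?pker_den.
apply: cvgD; last exact: cvg_cst.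
by apply: cvgM; (apply: cvgB; [exact: cvg_cst|exact: cvg_id]).
Qed.

Lemma measurable_pker a b : 0 < b -> measurable_fun setT (pker a b).
Proof. by move=> b0; apply: continuous_measurable_fun; exact: continuous_pker. Qed.

Lemma integrable_pker m a b : 0 < b ->
  m.-integrable setT (EFin \o pker a b).
Proof.
move=> b0; apply: (@bounded_integrable _ _ _ _ (b ^+ 2)^-1).
  exact: measurable_pker.
by move=> x; rewrite gtr0_norm ?pker_gt0 ?pker_le.
Qed.

Lemma integrable_pker1 m a b : 0 < b ->
  m.-integrable setT (EFin \o (fun x => (a - x) * pker a b x)).
Proof.
move=> b0; apply: (@bounded_integrable _ _ _ _ b^-1); last first.
  by move=> x; exact: pker1_le.
apply: measurable_funM; last exact: measurable_pker.
by apply: measurable_funB => //; exact: measurable_cst.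
Qed.

Definition Qint m a b := Rintegral m setT (pker a b).
Definition Uint m a b := Rintegral m setT (fun x => (a - x) * pker a b x).

Lemma cauchyGE m a b : 0 < b ->
  cauchyG m (a +i* b) = Uint m a b +i* (- (b * Qint m a b)).
Proof.
move=> b0; rewrite /cauchyG /cint /=.
have -> : Rintegral m setT (fun x => - ((b - 0) / ((a - x) ^+ 2 + (b - 0) ^+ 2)))
    = - (b * Qint m a b).
  rewrite -mulNr -RintegralZl//; last exact: integrable_pker.
  by apply: eq_Rintegral => x _; rewrite subr0 mulNr.
rewrite subr0; simpc; congr (_ +i* _).
Qed.

Lemma HfunE m a b : 0 < b ->
  let U := Uint m a b in let V := b * Qint m a b in
  Hfun m (a +i* b) = (U / (U ^+ 2 + V ^+ 2)) +i* (V / (U ^+ 2 + V ^+ 2)).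
Proof.
move=> b0 U V; rewrite /Hfun cauchyGE// -/U -/V.
rewrite -[LHS]/((_ / (_ + (- V) ^+ 2)) +i* (- (- V / (_ + (- V) ^+ 2)))).
by rewrite sqrrN mulNr opprK.
Qed.

Lemma Qint_gt0 m a b : (0 < m setT)%E -> 0 < b -> 0 < Qint m a b.
Proof.
move=> m0 b0; apply: Rintegral_gt0 => //; first exact: integrable_pker.
by move=> x; exact: pker_gt0.
Qed.

Lemma probability_gt0 mu : (0 < mu setT)%E.
Proof. by rewrite probability_setT. Qed.

(* The variance of [x |-> (z - x)^-1] is nonnegative. *)
Lemma sqr_cauchyG_le mu a b : 0 < b ->
  Uint mu a b ^+ 2 + (b * Qint mu a b) ^+ 2 <= Qint mu a b.
Proof.
move=> b0; set U := Uint mu a b; set Q := Qint mu a b.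
have Iq : mu.-integrable setT (EFin \o pker a b) by exact: integrable_pker.
have Ic : mu.-integrable setT (EFin \o (fun x => (a - x) * pker a b x)).
  exact: integrable_pker1.
have Zq c : mu.-integrable setT (EFin \o (fun x => c * pker a b x)).
  exact: integrableZlR.
have Zc c : mu.-integrable setT (EFin \o (fun x => c * ((a - x) * pker a b x))).
  exact: integrableZlR.
have IK c : mu.-integrable setT (EFin \o (fun _ : R => c)).
  exact: integrable_cstR.
have Zqc c d : mu.-integrable setT
    (EFin \o (fun x => c * pker a b x + d * ((a - x) * pker a b x))).
  exact: (integrableDR (Zq c) (Zc d)).
pose K := U ^+ 2 + (b * Q) ^+ 2.
(* [f] is |1 / (z - x) - G|^2, expanded and made linear in q by q |z - x|^2 = 1. *)
pose f x := (1 - 2 * b ^+ 2 * Q) * pker a b x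
  + (- 2 * U) * ((a - x) * pker a b x) + K.
have : 0 <= Rintegral mu setT f.
  apply: Rintegral_ge0 => x _; rewrite -[leRHS]/(f x).
  have -> : f x = ((a - x) * pker a b x - U) ^+ 2 +
      (b * pker a b x - b * Q) ^+ 2.
    rewrite /f /K; have : pker a b x * ((a - x) ^+ 2 + b ^+ 2) = 1.
      by rewrite mulVf// gt_eqF// pker_den.
    move: (pker a b x) => q h.
    have : q * (q * ((a - x) ^+ 2 + b ^+ 2)) = q by rewrite h mulr1.
    by lra.
  by rewrite addr_ge0 ?sqr_ge0.
rewrite /f RintegralD// RintegralD// !RintegralZl//.
rewrite Rintegral_cst// [X in fine X]probability_setT -/(Qint mu a b) -/(Uint mu a b).
by rewrite -/U -/Q /K /=; lra.
Qed.

Lemma Uint_le m a b : m `]-oo, 0[%classic = 0%E -> 0 < b ->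
  Uint m a b <= a * Qint m a b.
Proof.
move=> m0 b0; rewrite /Qint -RintegralZl//; last exact: integrable_pker.
apply: (le_Rintegral_null _ m0) => //; first exact: integrable_pker1.
  exact: (integrableZlR _ (integrable_pker m a b0)).
move=> x; rewrite /= in_itv/= => /negP; rewrite -leNgt => x0.
by apply: ler_wpM2r; [exact/ltW/pker_gt0|lra].
Qed.

(** Since a < 0, the variance inequality gives U <= aQ <= a |G|^2, and Re H = U / |G|^2. *)
Lemma Re_Hfun_le mu a b : mu `]-oo, 0[%classic = 0%E -> a < 0 -> 0 < b ->
  complex.Re (Hfun mu (a +i* b)) <= a.
Proof.
move=> mu0 a0 b0; rewrite HfunE//=.
have Q0 := Qint_gt0 a (probability_gt0 mu) b0.
have := sqr_cauchyG_le mu a b0; have := Uint_le a mu0 b0.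
set U := Uint _ _ _; set Q := Qint _ _ _ => UQa UQ.
have D0 : 0 < U ^+ 2 + (b * Q) ^+ 2.
  by rewrite ltr_wpDl ?sqr_ge0// exprn_gt0// mulr_gt0.
rewrite ler_pdivrMr//; apply: (le_trans UQa).
by rewrite ler_wnM2l// ltW.
Qed.

End cauchy_transform.

(** * Null intervals and supports *)

Section null_sets.
Context {R : realType}.
Implicit Types (m : {finite_measure set R -> \bar R}) (mu : probability R R).
Implicit Types a b x y A B C : R.

(** Chebyshev's inequality: q >= 1 / (2 b^2) within distance b of a. *)
Lemma measure_itv_le_Qint m a b : 0 < b ->
  (m `[(a - b)%R, (a + b)%R]%classic <= (2 * b ^+ 2 * Qint m a b)%:E)%E.
Proof.
move=> b0; have b2 : 0 < 2 * b ^+ 2 by rewrite mulr_gt0// exprn_gt0.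
set I := `[_, _]%classic; have mI : measurable I by exact: measurable_itv.
have mp : measurable_fun setT (EFin \o pker a b).
  by apply/measurable_EFinP; exact: measurable_pker.
have QE : (\int[m]_x (pker a b x)%:E = (Qint m a b)%:E)%E.
  by rewrite /Qint /Rintegral fineK// integrable_fin_num//; exact: integrable_pker.
rewrite EFinM -lee_pdivrMl// -QE -integral_cst//.
apply: (@le_trans _ _ (\int[m]_(x in I) (pker a b x)%:E)%E).
  apply: ge0_le_integral => //.
  - by move=> x _; rewrite lee_fin invr_ge0 ltW.
  - exact: measurable_funTS.
  - move=> x; rewrite /I/= in_itv/= => /andP[x1 x2].
    rewrite lee_fin lef_pV2 ?posrE ?pker_den//.
    have : `|a - x| <= b by rewrite ler_norml; lra.
    rewrite -[(a - x) ^+ 2]real_normK ?num_real//.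
    by have := normr_ge0 (a - x); nra.
apply: ge0_subset_integral => //.
by move=> x _; rewrite lee_fin ltW// pker_gt0.
Qed.

(** Balls of radius h around mesh points of step h cover the interval. About (B - A) / h of them are
    needed, each of mass at most 2 h^2 C, so the total is O(h). *)
Lemma null_itv_of_bounded_Qint m A B C : A < B ->
  (forall a b, A <= a <= B -> 0 < b < 1 -> Qint m a b <= C) ->
  m `[A, B]%classic = 0%E.
Proof.
move=> AB QC.
have C0 : 0 <= C.
  have h1 : A <= A <= B by rewrite lexx ltW.
  have h2 : 0 < (2^-1 : R) < 1 by lra.
  apply: le_trans (QC _ _ h1 h2); apply: Rintegral_ge0 => x _.
  by rewrite ltW// pker_gt0//; lra.
have step (h : R) k : 0 < h < 1 -> A + k%:R * h <= B ->
    (m `[A, (A + k%:R * h)%R]%classic <= (k.+1%:R * (2 * h ^+ 2 * C))%:E)%E.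
  move=> /andP[h0 h1]; elim: k => [|k ih] kB.
    apply: (@le_trans _ _ (m `[(A - h)%R, (A + h)%R]%classic)).
      apply: le_measure; rewrite ?inE//.
      by apply: subset_itv; rewrite bnd_simp; lra.
    apply: (le_trans (measure_itv_le_Qint _ _ h0)).
    rewrite lee_fin mul1r; apply: ler_wpM2l; first by rewrite mulr_ge0 ?sqr_ge0.
    by apply: QC; rewrite ?h0// lexx ltW.
  have hk : A + k%:R * h <= B.
    by move: kB; rewrite -(@natr1 R k) mulrDl; lra.
  have k0 : 0 <= k%:R * h by rewrite mulr_ge0// ltW.
  set a := A + k%:R * h.
  have sub : `[A, (A + k.+1%:R * h)%R]%classic `<=`
      `[A, a]%classic `|` `[(a - h)%R, (a + h)%R]%classic.
    move=> x; rewrite /= !in_itv/= -(@natr1 R k) mulrDl mul1r => /andP[x1 x2].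
    by have [xa|xa] := leP x a; [left|right]; rewrite ?x1//=; rewrite /a in xa *; lra.
  apply: (@le_trans _ _ (m (`[A, a]%classic `|` `[(a - h)%R, (a + h)%R]%classic))).
    by apply: le_measure; rewrite ?inE//; exact: measurableU.
  apply: (le_trans (measureU2 _ _ _)) => //.
  rewrite -(@natr1 R k.+1) mulrDl mul1r EFinD leeD ?ih//.
  apply: (le_trans (measure_itv_le_Qint _ _ h0)).
  rewrite lee_fin; apply: ler_wpM2l; first by rewrite mulr_ge0 ?sqr_ge0.
  by apply: QC; rewrite ?h0// /a hk andbT; lra.
have mfin : m `[A, B]%classic \is a fin_num by exact: fin_num_measure.
apply/eqP; rewrite eq_le measure_ge0 andbT -(fineK mfin) lee_fin.
set v := fine _; rewrite leNgt; apply/negP => v0.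
(* With h = (B - A) / (n + 1), the n + 2 balls have total mass at most D / (n + 1), because n + 2 <=
   2 (n + 1). The choice of [n] makes this smaller than [v] and also gives h < 1. *)
pose D := 4 * C * (B - A) ^+ 2.
have D0 : 0 <= D by apply: mulr_ge0 (sqr_ge0 _); exact: mulr_ge0.
pose n := Num.truncn ((B - A) + D / v).
have nlt : (B - A) + D / v < n.+1%:R by rewrite truncnS_gt.
have Dv : 0 <= D / v by rewrite divr_ge0// ltW.
have n0 : 0 < n.+1%:R :> R by [].
pose h := (B - A) / n.+1%:R.
have h01 : 0 < h < 1.
  by rewrite divr_gt0 ?subr_gt0//= ltr_pdivrMr// mul1r; lra.
have nh : A + n.+1%:R * h = B by rewrite /h mulrCA divff ?gt_eqF//; lra.
have := step h n.+1 h01; rewrite nh lexx => /(_ isT).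
rewrite -(fineK mfin) lee_fin -/v; apply/negP; rewrite -ltNge.
have : D < v * n.+1%:R by rewrite -ltr_pdivrMl// mulrC; lra.
rewrite -(ltr_pM2r (x := n.+1%:R^-1)) ?invr_gt0// mulfK ?gt_eqF//.
apply: le_lt_trans; rewrite /D /h.
have n2 : n.+2%:R <= 2 * n.+1%:R :> R by rewrite -natrM ler_nat mul2n -addnn -addn1 leq_add2l.
set w := n.+1%:R^-1.
have w1 : n.+1%:R * w = 1 by rewrite mulfV// gt_eqF.
have w0 : 0 < w by rewrite invr_gt0.
have -> : n.+2%:R * (2 * ((B - A) * w) ^+ 2 * C) =
  n.+2%:R * w * (w * (2 * C * (B - A) ^+ 2)) by ring.
have -> : 4 * C * (B - A) ^+ 2 * w = 2 * (w * (2 * C * (B - A) ^+ 2)) by ring.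
apply: ler_wpM2r; first by apply: mulr_ge0 (ltW w0) _; apply: mulr_ge0 (sqr_ge0 _); exact: mulr_ge0.
by rewrite -ler_pdivlMr// invrK.
Qed.

Lemma null_neg_of_itv m :
  (forall A B, A < B -> B < 0 -> m `[A, B]%classic = 0%E) ->
  m `]-oo, 0[%classic = 0%E.
Proof.
move=> m0; apply: (measure_negligible (measurable_itv _)).
suff sub : `]-oo, (0 : R)[%classic `<=`
    (* The extra -1 keeps the interval nondegenerate at n = 0. *)
    \bigcup_n `[- n.+1%:R - 1, - n.+1%:R^-1]%classic.
  apply: (negligibleS sub); apply: negligible_bigcup => n.
  exists `[- n.+1%:R - 1, - n.+1%:R^-1]%classic.
  split => //; apply: m0; last by rewrite oppr_lt0.
  have : n.+1%:R^-1 <= (1 : R) by rewrite invf_le1// ler1n.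
  have : 0 < (n.+1%:R : R) by []. move: (n.+1%:R : R) => N; lra.
move=> x; rewrite /= in_itv/= => x0.
have xx : x * x^-1 = 1 by rewrite divff// lt_eqF.
have xi0 : x^-1 < 0 by rewrite invr_lt0.
(* Both -x and -1/x are positive, so an integer above their sum exceeds each of them. *)
exists (Num.truncn (- x - x^-1)) => //=.
have := truncnS_gt (- x - x^-1); set N := _%:R => Nlt.
have N0 : 0 < N by lra.
rewrite in_itv/=; apply/andP; split; first lra.
by rewrite lerNr -[leRHS]invrK lef_pV2 ?posrE ?invr_gt0 ?oppr_gt0// invrN; lra.
Qed.

Lemma suppPn m x : ~ supp m x <-> exists r, 0 < r /\ m (ball x r) = 0%E.
Proof.
split; last by move=> [r [r0 mr]] /(_ r r0); rewrite [X in (_ < X)%E]mr ltxx.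
move=> /existsNP[r /not_implyP[r0 /negP]]; rewrite -leNgt measure_le0 => /eqP mr.
by exists r.
Qed.

(** Lindelof argument: every negative point lies outside the support, hence in a null ball with
    rational centre and radius, and there are countably many such balls. *)
Lemma supp_nonnegP m :
  supp m `<=` [set x | 0 <= x] <-> m `]-oo, 0[%classic = 0%E.
Proof.
split=> [sm|m0 x /=]; last first.
  rewrite leNgt; apply: contraPN => x0; apply/suppPn; exists (- x).
  rewrite oppr_gt0; split=> //; apply/eqP; rewrite -measure_le0 -[leRHS]m0.
  apply: le_measure; rewrite ?inE//; first exact: measurable_ball.
  move=> y; rewrite /ball/= in_itv/= ltr_norml; lra.
pose F (p : rat * rat) : set R :=
  if m (ball (ratr p.1 : R) (ratr p.2)) == 0%E then ball (ratr p.1 : R) (ratr p.2)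
  else set0.
apply: (measure_negligible (measurable_itv _)).
suff sub : `]-oo, (0 : R)[%classic `<=`
    \bigcup_n (if unpickle n is Some p then F p else set0).
  apply: (negligibleS sub); apply: negligible_bigcup => n.
  case: unpickle => [p|]; last exact: negligible_set0.
  rewrite /F; case: eqP => [mp|_]; last exact: negligible_set0.
  by exists (ball (ratr p.1 : R) (ratr p.2)); split=> //; exact: measurable_ball.
move=> x; rewrite /= in_itv/= => x0.
have /suppPn[r [r0 mr]] : ~ supp m x by move=> /sm/=; rewrite leNgt x0.
(* A centre within [q2] of x and a radius [q2] < r / 2 give a ball that contains x and stays inside
   the null ball of radius r. *)
have [q2] : exists q, (ratr q : R) \in `](0 : R), r / 2[%R.
  apply: rat_in_itvoo. lra.
rewrite in_itv/= => /andP[q20 q2r].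
have [q1] : exists q, (ratr q : R) \in `](x - ratr q2), (x + ratr q2)[%R.
  by apply: rat_in_itvoo; lra.
rewrite in_itv/= => /andP[q1l q1r].
exists (pickle (q1, q2)); first exact: I.
rewrite pickleK /F -[(q1, q2).1]/q1 -[(q1, q2).2]/q2.
have -> : m (ball (ratr q1 : R) (ratr q2)) == 0%E.
  rewrite -measure_le0 -[leRHS]mr; apply: le_measure; rewrite ?inE//.
  - exact: measurable_ball.
  - exact: measurable_ball.
  - move=> y; rewrite /ball/= !ltr_norml; lra.
rewrite /ball/= ltr_norml; lra.
Qed.

End null_sets.

(** * Linearity of K in time *)

Section boolean_linearity.
Context {R : realType}.
Implicit Types (m tau : {finite_measure set R -> \bar R}) (mu : probability R R).
Implicit Types a b x y A B C s t : R.

(** Cauchy's functional equation. The difference [g] of f and its linear candidate is additive and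
    vanishes at s = 1/k < d, so reducing modulo s bounds it on the whole half-line. Then N g(t) =
    g(N t) stays bounded in N, which forces g(t) = 0. *)
Lemma additive_bounded_linear (f : R -> R) C (d : R) :
  (forall s t, 0 <= s -> 0 <= t -> f (s + t) = f s + f t) ->
  0 < d -> (forall t, 0 <= t < d -> `|f t| <= C) ->
  forall t, 0 <= t -> f t = t * f 1.
Proof.
move=> fD d0 fC.
pose g t := f t - t * f 1; pose C' := C + d * `|f 1|.
have gD s t : 0 <= s -> 0 <= t -> g (s + t) = g s + g t.
  by move=> s0 t0; rewrite /g fD//; lra.
have gC t : 0 <= t < d -> `|g t| <= C'.
  move=> td; rewrite (le_trans (ler_normB _ _))// lerD ?fC// normrM.
  by apply: ler_wpM2r; rewrite ?normr_ge0// ger0_norm; lra.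
have g0 : g 0 = 0 by have := gD 0 0 (lexx _) (lexx _); rewrite addr0; lra.
have gM t n : 0 <= t -> g (n%:R * t) = n%:R * g t.
  move=> t0; elim: n => [|n ih]; first by rewrite !mul0r.
  by rewrite -(@natr1 R n) !mulrDl !mul1r gD ?ih// mulr_ge0.
pose k := (Num.truncn d^-1).+1; pose s : R := k%:R^-1.
have k0 : 0 < k%:R :> R by [].
have s0 : 0 < s by rewrite invr_gt0.
have sd : s < d.
  by rewrite /s -[ltRHS]invrK ltf_pV2 ?posrE ?invr_gt0// truncnS_gt.
have gs : g s = 0.
  have := gM s k (ltW s0); rewrite mulfV ?gt_eqF// /g mul1r subrr => /esym/eqP.
  by rewrite mulf_eq0 gt_eqF//= => /eqP.
move=> t t0; apply/eqP; rewrite -subr_eq0 -/(g t) -normr_le0 leNgt.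
apply/negP => gt0.
have Nb (N : nat) : N%:R * `|g t| <= C'.
  rewrite -[N%:R]ger0_norm// -normrM -gM//.
  have Nt0 : 0 <= N%:R * t / s by rewrite divr_ge0 ?mulr_ge0// ltW.
  pose m := Num.truncn (N%:R * t / s).
  have /andP[m1 m2] := truncn_itv Nt0.
  rewrite ler_pdivlMr// in m1; rewrite ltr_pdivrMr// in m2.
  have -> : N%:R * t = m%:R * s + (N%:R * t - m%:R * s) by ring.
  rewrite -(@natr1 R) mulrDl mul1r in m2.
  rewrite gD ?subr_ge0 ?mulr_ge0 ?(ltW s0)// gM ?(ltW s0)// gs mulr0 add0r.
  by apply: gC; rewrite /m; lra.
have := Nb (Num.truncn (C' / `|g t|)).+1; apply/negP; rewrite -ltNge.
by rewrite -ltr_pdivrMr// truncnS_gt.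
Qed.

(** The two fractions are the parts of 1 / (U - iV), whose modulus is at most 1 / V. *)
Lemma normr_frac_le (U V : R) : 0 < V ->
  `|U / (U ^+ 2 + V ^+ 2)| <= V^-1 /\ `|V / (U ^+ 2 + V ^+ 2)| <= V^-1.
Proof.
move=> V0; have D0 : 0 < U ^+ 2 + V ^+ 2 by rewrite ltr_wpDl ?sqr_ge0// exprn_gt0.
have V2 : 0 < V ^+ 2 by rewrite exprn_gt0.
rewrite !normrM (gtr0_norm V0) [`|_^-1|]gtr0_norm ?invr_gt0//.
split; rewrite ler_pdivrMr// mulrC ler_pdivlMr//.
  by rewrite -[U ^+ 2]real_normK ?num_real//; nra.
by rewrite expr2; have := sqr_ge0 U; nra.
Qed.

(** Weak continuity at time 0, tested on the kernel [pker], keeps Q above half its initial value for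
    small times. This bounds H, hence K, so each part of K is an additive function of time bounded
    near 0. *)
Lemma boolean_semigroup_linear (mu : R -> probability R R) :
  boolean_semigroup mu -> forall a b t, 0 < b -> 0 <= t ->
  complex.Re (Kfun (mu t) (a +i* b)) = t * complex.Re (Kfun (mu 1) (a +i* b)) /\
  complex.Im (Kfun (mu t) (a +i* b)) = t * complex.Im (Kfun (mu 1) (a +i* b)).
Proof.
move=> [wc bc] a b t b0 t0; pose Q t := Qint (mu t) a b.
have Q0 s : 0 < Q s by apply: Qint_gt0 => //; exact: probability_gt0.
have pb : exists C : R, forall x, `|pker a b x| <= C.
  by exists (b ^+ 2)^-1 => x; rewrite gtr0_norm ?pker_gt0// pker_le.
have [|d [d0 dQ]] := wc _ (@continuous_pker _ a b b0) pb 0 (lexx _) (Q 0 / 2).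
  by rewrite divr_gt0.
have Vb s : 0 <= s < d -> (b * Q s)^-1 <= 2 / (b * Q 0).
  move=> /andP[s0 sd]; have := dQ s s0; rewrite subr0 (ger0_norm s0) => /(_ sd).
  rewrite ltr_norml => /andP[h _]; have {}h : - (Q 0 / 2) < Q s - Q 0 := h.
  rewrite -[2]invrK -invfM lef_pV2 ?posrE ?mulr_gt0// ?invr_gt0//.
  by rewrite mulrCA; apply: ler_wpM2l; [exact: ltW|lra].
have HE s := HfunE (mu s) a b0.
split.
- apply: (@additive_bounded_linear (fun t => complex.Re (Kfun (mu t) (a +i* b)))
    (`|a| + 2 / (b * Q 0)) d) => //.
  + by move=> s u s0 u0; rewrite bc//=.
  + move=> s sd; rewrite /Kfun HE /=; rewrite (le_trans (ler_normB _ _))//.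
    rewrite lerD2l (le_trans _ (Vb s sd))//.
    by have [] := @normr_frac_le (Uint (mu s) a b) (b * Q s) (mulr_gt0 b0 (Q0 s)).
- apply: (@additive_bounded_linear (fun t => complex.Im (Kfun (mu t) (a +i* b)))
    (`|b| + 2 / (b * Q 0)) d) => //.
  + by move=> s u s0 u0; rewrite bc//=.
  + move=> s sd; rewrite /Kfun HE /=; rewrite (le_trans (ler_normB _ _))//.
    rewrite lerD2l (le_trans _ (Vb s sd))//.
    by have [] := @normr_frac_le (Uint (mu s) a b) (b * Q s) (mulr_gt0 b0 (Q0 s)).
Qed.

(** * The Nevanlinna kernel (1 + xz) / (x - z) *)

Definition nevRe a b x :=
  (x - a + x ^+ 2 * a - x * (a ^+ 2 + b ^+ 2)) * pker a b x.
Definition nevIm a b x := b * (1 + x ^+ 2) * pker a b x.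

Lemma nevE a b x : (1 + x%:C * (a +i* b)) / (x%:C - (a +i* b)) =
  nevRe a b x +i* nevIm a b x.
Proof.
rewrite -[LHS]/(((1 + (x * a - 0 * b)) * ((x - a) / ((x - a) ^+ 2 + (0 - b) ^+ 2))
    - (0 + (x * b + 0 * a)) * - ((0 - b) / ((x - a) ^+ 2 + (0 - b) ^+ 2)))
  +i* ((1 + (x * a - 0 * b)) * - ((0 - b) / ((x - a) ^+ 2 + (0 - b) ^+ 2))
    + (0 + (x * b + 0 * a)) * ((x - a) / ((x - a) ^+ 2 + (0 - b) ^+ 2)))).
rewrite /nevRe /nevIm /pker; have -> : (x - a) ^+ 2 + (0 - b) ^+ 2 =
  (a - x) ^+ 2 + b ^+ 2 by ring.
by congr (_ +i* _); ring.
Qed.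

Lemma pkerV a b x : 0 < b -> pker a b x * ((a - x) ^+ 2 + b ^+ 2) = 1.
Proof. by move=> b0; rewrite mulVf// gt_eqF// pker_den. Qed.

(** The relation q |z - x|^2 = 1 absorbs the growth in x and leaves a combination of the bounded
    functions 1, (a - x) q and q, so integrability can be read off. *)
Lemma nevReE a b x : 0 < b -> nevRe a b x =
  a + - (1 + a ^+ 2 - b ^+ 2) * ((a - x) * pker a b x)
  + (- (2 * a * b ^+ 2)) * pker a b x.
Proof.
move=> b0; rewrite /nevRe; have := pkerV a x b0; move: (pker a b x) => q h.
have h2 : a * (q * ((a - x) ^+ 2 + b ^+ 2)) = a by rewrite h mulr1.
by lra.
Qed.

Lemma nevImE a b x : 0 < b -> nevIm a b x =
  b + (- (2 * a * b)) * ((a - x) * pker a b x)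
  + (b * (1 + a ^+ 2 - b ^+ 2)) * pker a b x.
Proof.
move=> b0; rewrite /nevIm; have := pkerV a x b0; move: (pker a b x) => q h.
have h2 : b * (q * ((a - x) ^+ 2 + b ^+ 2)) = b by rewrite h mulr1.
by lra.
Qed.

Section nevanlinna_integrable.
Variables (tau : {finite_measure set R -> \bar R}) (a b : R).
Hypothesis b0 : 0 < b.

Let Ic c : tau.-integrable setT (EFin \o (fun x => c * ((a - x) * pker a b x))).
Proof. by apply: integrableZlR; exact: integrable_pker1. Qed.

Let Iq c : tau.-integrable setT (EFin \o (fun x => c * pker a b x)).
Proof. by apply: integrableZlR; exact: integrable_pker. Qed.

Let I3 c d e : tau.-integrable setT
  (EFin \o (fun x => c + d * ((a - x) * pker a b x) + e * pker a b x)).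
Proof.
by apply: integrableDR => //; apply: integrableDR => //; exact: integrable_cstR.
Qed.

Lemma integrable_nevRe : tau.-integrable setT (EFin \o nevRe a b).
Proof.
by rewrite (funext (fun x => nevReE a x b0)).
Qed.

Lemma integrable_nevIm : tau.-integrable setT (EFin \o nevIm a b).
Proof.
by rewrite (funext (fun x => nevImE a x b0)).
Qed.

End nevanlinna_integrable.

Lemma cint_nev tau a b : cint tau (fun x => (1 + x%:C * (a +i* b)) / (x%:C - (a +i* b))) =
  Rintegral tau setT (nevRe a b) +i* Rintegral tau setT (nevIm a b).
Proof.
rewrite /cint.
have -> : (fun x => complex.Re ((1 + x%:C * (a +i* b)) / (x%:C - (a +i* b)))) = nevRe a b.
  by apply/funext => x; rewrite nevE.
have -> : (fun x => complex.Im ((1 + x%:C * (a +i* b)) / (x%:C - (a +i* b)))) = nevIm a b.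
  by apply/funext => x; rewrite nevE.
by simpc.
Qed.

(** * From the Nevanlinna representation to the support of the law *)

Section nevanlinna.
Variables (mu : probability R R) (tau : {finite_measure set R -> \bar R}).
Variables (t gamma : R).
Hypothesis HRe : forall a b, 0 < b ->
  complex.Re (Hfun mu (a +i* b)) = a - t * (gamma - Rintegral tau setT (nevRe a b)).
Hypothesis HIm : forall a b, 0 < b ->
  complex.Im (Hfun mu (a +i* b)) = b + t * Rintegral tau setT (nevIm a b).

Let T := fine (tau setT).

Let intK c : Rintegral tau setT (fun _ => c) = c * T.
Proof. by rewrite Rintegral_cst. Qed.

(** For a in [A, B] the hypothesis gives Re H <= a <= B < 0, so |G|^2 <= 1 / B^2. With Im H <= M b
    and bQ = |G|^2 Im H, this bounds Q by M / B^2 uniformly in b. *)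
Lemma supp_boolean_of_nevanlinna : 0 <= t -> tau `]-oo, 0]%classic = 0%E ->
  (forall a b, a < 0 -> 0 < b -> Rintegral tau setT (nevRe a b) <= gamma) ->
  mu `]-oo, 0[%classic = 0%E.
Proof.
move=> t0 tau0 Rg; apply: null_neg_of_itv => A B AB B0.
have T0 : 0 <= T by rewrite fine_ge0.
(* For x > 0 and a <= B < 0 one has |z - x|^2 >= x^2 + B^2, hence (1 + x^2) q <= 1 + 1 / B^2; so [M]
   bounds Im H / b. *)
pose M := 1 + t * ((1 + (B ^+ 2)^-1) * T).
apply: (@null_itv_of_bounded_Qint _ mu _ _ (M / B ^+ 2)) => // a b aAB b01.
have a0 : a < 0 by lra.
have b0 : 0 < b by lra.
have Q0 := Qint_gt0 a (probability_gt0 mu) b0.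
have nI : Rintegral tau setT (nevIm a b) <= b * ((1 + (B ^+ 2)^-1) * T).
  rewrite mulrA -intK; apply: (le_Rintegral_null _ tau0) => //.
  - exact: integrable_nevIm.
  - exact: integrable_cstR.
  - move=> x; rewrite /= in_itv/= => /negP; rewrite -ltNge => x0.
    rewrite /nevIm -mulrA; apply: ler_wpM2l; first exact: ltW.
    rewrite ler_pdivrMr ?pker_den//.
    have B2 : 0 < B ^+ 2 by rewrite exprn_even_gt0//= lt_eqF.
    have BV : (B ^+ 2)^-1 * B ^+ 2 = 1 by rewrite mulVf// gt_eqF.
    have BV0 : 0 < (B ^+ 2)^-1 by rewrite invr_gt0.
    move: (_^-1) BV BV0 => w BV BV0.
    have h1 : x ^+ 2 + B ^+ 2 <= (a - x) ^+ 2 + b ^+ 2 by nra.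
    apply: (@le_trans _ _ ((1 + w) * (x ^+ 2 + B ^+ 2))); first nra.
    by apply: ler_wpM2l => //; lra.
have := HIm a b0; have := HRe a b0; have := Rg a b a0 b0.
rewrite HfunE//=; set U := Uint _ _ _; set Q := Qint _ _ _ in Q0 *.
set rR := Rintegral _ _ _; set rI := Rintegral _ _ _ in nI *.
have D0 : 0 < U ^+ 2 + (b * Q) ^+ 2.
  by rewrite ltr_wpDl ?sqr_ge0// exprn_gt0// mulr_gt0.
have DU : U ^+ 2 <= U ^+ 2 + (b * Q) ^+ 2 by rewrite lerDl sqr_ge0.
(* Here [D] is |G|^2, and the next two facts recover the parts of G from those of H. *)
move: (U ^+ 2 + _) D0 DU => D D0 DU rg hR hI.
have UD : U = D * (a - t * (gamma - rR)) by rewrite -hR mulrCA mulfV ?mulr1// gt_eqF.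
have QD : b * Q = D * (b + t * rI) by rewrite -hI mulrCA mulfV ?mulr1// gt_eqF.
have ReB : a - t * (gamma - rR) <= B.
  have : 0 <= t * (gamma - rR) by rewrite mulr_ge0// subr_ge0.
  by lra.
have B2 : 0 < B ^+ 2 by rewrite exprn_even_gt0//= lt_eqF.
(* D^2 B^2 <= D^2 (Re H)^2 = U^2 <= D, and one factor [D] cancels. *)
have DB : D * B ^+ 2 <= 1.
  rewrite -(ler_pM2l D0) mulr1 (le_trans _ DU)// UD exprMn mulrA -expr2.
  by apply: ler_wpM2l; [exact: sqr_ge0|nra].
have QM : Q <= D * M.
  rewrite -(ler_pM2l b0) QD mulrCA; apply: ler_wpM2l; first exact: ltW.
  by rewrite /M mulrDr mulr1 lerD2l mulrCA; apply: ler_wpM2l.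
rewrite ler_pdivlMr//; apply: (@le_trans _ _ (D * M * B ^+ 2)).
  by rewrite ler_wpM2r// ltW.
have M0 : 0 <= M.
  rewrite /M addr_ge0// !mulr_ge0// addr_ge0// invr_ge0 ltW//.
by rewrite mulrAC ler_piMl.
Qed.

End nevanlinna.
End boolean_linearity.

(** * The integral of 1/x as a limit *)

Section inverse_moment.
Context {R : realType}.
Implicit Types (m tau : {finite_measure set R -> \bar R}) (mu : probability R R).
Implicit Types a b x y A B C s t gamma : R.

(** For x >= 0 the distance from z to x is at most that from A + i to x. This bounds Q from below
    uniformly on the strip. *)
Lemma Qint_ge m A a b : m `]-oo, 0[%classic = 0%E ->
  A <= a -> a < 0 -> 0 < b < 1 -> Qint m A 1 <= Qint m a b.
Proof.
move=> m0 Aa a0 /andP[b0 b1].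
apply: (le_Rintegral_null _ m0) => //; try exact: integrable_pker.
move=> x; rewrite /= in_itv/= => /negP; rewrite -leNgt => x0.
by rewrite lef_pV2 ?posrE ?pker_den//; nra.
Qed.

Lemma measurable_invr_pos :
  measurable_fun [set x : R | 0 < x] (fun x => (x^-1)%:E).
Proof.
apply/measurable_EFinP; apply: open_continuous_measurable_fun.
  by have -> : [set x : R | 0 < x] = `]0, +oo[%classic by rewrite set_itvoy.
by move=> x; rewrite inE/= => x0; apply: inv_continuous; rewrite gt_eqF.
Qed.

Lemma measurable_pos : measurable [set x : R | 0 < x].
Proof.
by have -> : [set x : R | 0 < x] = `]0, +oo[%classic by rewrite set_itvoy.
Qed.

(** The absolute value makes 1 / (x + 2s) bounded and continuous on the whole line without changing
    it for x >= 0. *)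
Lemma integrable_invr_shift m s : 0 < s ->
  m.-integrable setT (EFin \o (fun x => (`|x| + 2 * s)^-1)).
Proof.
move=> s0; have d0 x : 0 < `|x| + 2 * s by have := normr_ge0 x; lra.
apply: (@bounded_integrable _ _ _ _ _ (2 * s)^-1); last first.
  move=> x; rewrite gtr0_norm ?invr_gt0//.
  by rewrite lef_pV2 ?posrE// ?lerDr ?normr_ge0//; lra.
apply: continuous_measurable_fun => x; apply: cvgV; first by rewrite gt_eqF.
by apply: cvgD; [exact: norm_continuous|exact: cvg_cst].
Qed.

(** An atom of mass v at 0 contributes v / (2s) to the integral, so v <= 2s (gamma + s D) for all
    small s and v = 0. The bound on the integral of 1/x follows by monotone convergence as s
    decreases to 0. *)
Lemma integral_invr_le m gamma D :
  (forall s, 0 < s < 1 ->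
    Rintegral m setT (fun x => (`|x| + 2 * s)^-1) <= gamma + s * D) ->
  m [set 0] = 0%E /\
  (\int[m]_(x in [set x : R | (0 < x)%R]) ((x^-1)%R)%:E <= gamma%:E)%E.
Proof.
move=> H; split.
  have mfin : m [set 0] \is a fin_num by exact: fin_num_measure.
  apply/eqP; rewrite eq_le measure_ge0 andbT -(fineK mfin) lee_fin.
  set v := fine _; rewrite leNgt; apply/negP => v0.
  have vs s : 0 < s < 1 -> v <= 2 * s * (gamma + s * D).
    move=> s01; have s0 : 0 < s by lra.
    rewrite -ler_pdivrMl; last lra.
    apply: le_trans (H s s01).
    have If := integrable_invr_shift m s0.
    rewrite -lee_fin /Rintegral fineK; last exact: integrable_fin_num.
    apply: (@le_trans _ _ (\int[m]_(x in [set 0%R]) ((2 * s)^-1)%:E)%E).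
      by rewrite integral_cst//= EFinM (fineK mfin).
    apply: (@le_trans _ _ (\int[m]_(x in [set 0%R]) ((`|x| + 2 * s)^-1)%:E)%E).
      apply: ge0_le_integral => //.
      - by move=> x _; rewrite lee_fin invr_ge0; lra.
      - exact: measurable_funTS (measurable_int _ If).
      - by move=> x /= ->; rewrite normr0 add0r.
    apply: ge0_subset_integral => //; first exact: (measurable_int _ If).
    by move=> x _; rewrite lee_fin invr_ge0; have := normr_ge0 x; lra.
  (* [K] exceeds gamma + s D for every s in (0, 1), and its summand [v] ensures that s = v / (2K) is
     below 1. *)
  pose K := 2 * (`|gamma| + `|D|) + v + 1.
  have K0 : 0 < K by have := normr_ge0 gamma; have := normr_ge0 D; rewrite /K; lra.
  pose s := v / (2 * K).
  have s01 : 0 < s < 1.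
    rewrite divr_gt0 ?mulr_gt0//= ltr_pdivrMr ?mulr_gt0// mul1r /K.
    by have := normr_ge0 gamma; have := normr_ge0 D; lra.
  have := vs s s01; apply/negP; rewrite -ltNge.
  have sK : 2 * s * K = v by rewrite /s; field; rewrite gt_eqF.
  rewrite -[ltRHS]sK; apply: (@lt_le_trans _ _ (2 * s * K)) => //.
  have := ler_norm gamma; have := ler_norm D; have := normr_ge0 gamma.
  have := normr_ge0 D => D1 g1 D2 g2.
  rewrite ltr_pM2l; last lra.
  have /andP[s_gt0 s_lt1] := s01.
  have : s * D <= `|D|.
    apply: (@le_trans _ _ (s * `|D|)); first by apply: ler_wpM2l => //; exact: ltW.
    by apply: ler_piMl => //; exact: ltW.
  by rewrite /K; lra.
(* The sequence s = 1 / (n + 2) stays strictly below 1 from n = 0 on. *)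
pose g (n : nat) x := ((`|x| + 2 * (n.+2%:R)^-1)^-1)%:E.
have s01 n : 0 < (n.+2%:R^-1 : R) < 1 by rewrite invr_gt0 ltr0n invf_lt1// ltr1n.
have s0 n : 0 < (n.+2%:R^-1 : R) by have /andP[] := s01 n.
have d0 n x : 0 < `|x| + 2 * n.+2%:R^-1.
  by rewrite ltr_wpDl// mulr_gt0.
have mg n : measurable_fun setT (g n).
  exact: (measurable_int _ (integrable_invr_shift m (s0 n))).
have gle n : (\int[m]_(x in [set x : R | (0 < x)%R]) g n x <=
    (gamma + n.+2%:R^-1 * D)%:E)%E.
  apply: (@le_trans _ _ (\int[m]_x g n x)%E).
    apply: ge0_subset_integral => //; first exact: measurable_pos.
    by move=> x _; rewrite lee_fin invr_ge0 ltW.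
  have If := integrable_invr_shift m (s0 n).
  have -> : (\int[m]_x g n x = (Rintegral m setT
      (fun x => (`|x| + 2 * n.+2%:R^-1)^-1)%R)%:E)%E.
    by rewrite /Rintegral fineK// integrable_fin_num.
  by rewrite lee_fin; exact: H.
have cvg_harmonic2 : (n.+2%:R^-1 : R) @[n --> \oo] --> (0 : R).
  by have := @cvg_harmonic R; rewrite -cvg_shiftS.
have cg x : 0 < x -> g n x @[n --> \oo] --> (x^-1)%:E.
  move=> x0; apply: cvg_EFin; first exact: nearW.
  apply: cvgV; first by rewrite gt_eqF.
  rewrite gtr0_norm// -[X in _ --> X]addr0 -[X in _ + X](mulr0 2).
  by apply: cvgD; [exact: cvg_cst|apply: cvgM; [exact: cvg_cst|exact: cvg_harmonic2]].
have -> : (\int[m]_(x in [set x : R | (0 < x)%R]) ((x^-1)%R)%:E =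
  \int[m]_(x in [set x : R | (0 < x)%R]) limn (g ^~ x))%E.
  by apply: eq_integral => x; rewrite inE/= => x0; apply/esym/cvg_lim => //; exact: cg.
have cI : (\int[m]_(x in [set x : R | (0 < x)%R]) g n x)%E @[n --> \oo] -->
    (\int[m]_(x in [set x : R | (0 < x)%R]) limn (g ^~ x))%E.
  apply: cvg_monotone_convergence => //.
  - exact: measurable_pos.
  - by move=> n; exact: measurable_funTS.
  - by move=> n x _; rewrite lee_fin invr_ge0 ltW.
  - move=> x _ n k nk; rewrite lee_fin lef_pV2 ?posrE// lerD2l.
    by rewrite ler_pM2l// lef_pV2 ?posrE ?ltr0n// ler_nat !ltnS.
apply: (lee_cvg_to cI (g := fun n => (gamma + n.+2%:R^-1 * D)%:E)).
  apply: cvg_EFin; first exact: nearW.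
  rewrite -[X in _ --> X]addr0 -[X in _ + X](mul0r D).
  apply: cvgD; first exact: cvg_cst.
  by apply: cvgM; [exact: cvg_harmonic2|exact: cvg_cst].
by apply: nearW => n; exact: gle.
Qed.
End inverse_moment.

(** * Equivalence of the three conditions *)

Section boolean_support.
Context {R : realType}.
Implicit Types (m tau : {finite_measure set R -> \bar R}) (mu : probability R R).
Implicit Types a b x y A B C s t gamma : R.

Section forward.
Variables (mu : probability R R) (tau : {finite_measure set R -> \bar R}).
Variables (t gamma : R).
Hypothesis HRe : forall a b, 0 < b ->
  complex.Re (Hfun mu (a +i* b)) = a - t * (gamma - Rintegral tau setT (nevRe a b)).
Hypothesis HIm : forall a b, 0 < b ->
  complex.Im (Hfun mu (a +i* b)) = b + t * Rintegral tau setT (nevIm a b).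
Hypothesis t0 : 0 < t.
Hypothesis mu0 : mu `]-oo, 0[%classic = 0%E.

(** For a <= B < 0, U <= BQ gives |G|^2 >= B^2 Q^2, so Im H = bQ / |G|^2 <= b / (B^2 Q), with Q at
    least [Q0]. Since 1 + x^2 >= 1, Im H also dominates t b times the integral of q against [tau],
    which is therefore bounded. *)
Lemma nevanlinna_null_neg : tau `]-oo, 0[%classic = 0%E.
Proof.
apply: null_neg_of_itv => A B AB B0.
pose Q0 := Qint mu A 1.
have Q00 : 0 < Q0 by apply: Qint_gt0 => //; exact: probability_gt0.
have B2 : 0 < B ^+ 2 by rewrite exprn_even_gt0//= lt_eqF.
apply: (@null_itv_of_bounded_Qint _ tau _ _ ((t * (B ^+ 2 * Q0))^-1)) => // a b.
move=> /andP[Aa aB] b01; have a0 : a < 0 by lra.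
have b0 : 0 < b by lra.
have QQ0 : Q0 <= Qint mu a b by exact: Qint_ge.
have := Uint_le a mu0 b0; have := HIm a b0; rewrite HfunE//=.
set U := Uint _ _ _; set Q := Qint mu a b in QQ0 * => hI UQ.
have Q_gt0 : 0 < Q by lra.
have nI : b * Qint tau a b <= Rintegral tau setT (nevIm a b).
  rewrite /Qint -RintegralZl//; last exact: integrable_pker.
  apply: le_Rintegral => //; [exact/integrableZlR/integrable_pker|exact: integrable_nevIm|].
  move=> x _; apply: ler_wpM2r; first by rewrite ltW// pker_gt0.
  by have := sqr_ge0 x; nra.
have hQ : b * Q / (U ^+ 2 + (b * Q) ^+ 2) <= b / (B ^+ 2 * Q0).
  have D0 : 0 < U ^+ 2 + (b * Q) ^+ 2.
    by rewrite ltr_wpDl ?sqr_ge0// exprn_gt0// mulr_gt0.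
  have B2Q0 : 0 < B ^+ 2 * Q0 by exact: mulr_gt0.
  rewrite ler_pdivrMr// mulrAC ler_pdivlMr// -mulrA.
  apply: ler_wpM2l; first exact: ltW.
  have BQ : U <= B * Q by apply: (le_trans UQ); apply: ler_wpM2r => //; exact: ltW.
  have BQ0 : B * Q < 0 by rewrite nmulr_rlt0.
  have UB : (B * Q) ^+ 2 <= U ^+ 2 by nra.
  apply: (@le_trans _ _ (U ^+ 2)); last by rewrite lerDl sqr_ge0.
  apply: le_trans UB.
  have -> : (B * Q) ^+ 2 = Q * (B ^+ 2 * Q) by ring.
  by do 2! (apply: ler_wpM2l; first exact: ltW).
rewrite invfM -ler_pdivrMl ?invr_gt0// invrK.
rewrite -(ler_pM2l b0); apply: le_trans hQ.
rewrite hI mulrCA -[leLHS]add0r; apply: lerD; first exact: ltW.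
by apply: ler_wpM2l => //; exact: ltW.
Qed.

(** With D = (x + s)^2 + s^2, the right-hand side equals (x + s + 2 s^3) / D, and (x + s)(x + 2s) =
    D + xs >= D. *)
Lemma invr_shift_le_nevRe s x : 0 < s -> 0 <= x ->
  (`|x| + 2 * s)^-1 <= nevRe (- s) s x + s.
Proof.
move=> s0 x0; rewrite ger0_norm// /nevRe /pker.
have D0 : 0 < (- s - x) ^+ 2 + s ^+ 2 by exact: pker_den.
have E0 : 0 < x + 2 * s by lra.
rewrite -[leLHS]mul1r ler_pdivrMr// mulrDl mulrAC.
rewrite -lerBlDr ler_pdivlMr//.
nra.
Qed.

(** The inequality Re H <= Re z at z = -s + is bounds the integral of [nevRe] by gamma, as t > 0;
    the added constant s integrates to s tau(R). *)
Lemma nevanlinna_integral_le s : 0 < s < 1 ->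
  Rintegral tau setT (fun x => (`|x| + 2 * s)^-1) <=
  gamma + s * fine (tau setT).
Proof.
move=> /andP[s0 s1]; have tau0 := nevanlinna_null_neg.
apply: (@le_trans _ _ (Rintegral tau setT (fun x => nevRe (- s) s x + s))).
  apply: (le_Rintegral_null _ tau0) => //.
  - exact: integrable_invr_shift.
  - apply: integrableDR; [exact: integrable_nevRe|exact: integrable_cstR].
  - move=> x; rewrite /= in_itv/= => /negP; rewrite -leNgt => x0.
    exact: invr_shift_le_nevRe.
rewrite RintegralD//; [|exact: integrable_nevRe|exact: integrable_cstR].
rewrite Rintegral_cst// lerD2r.
have := Re_Hfun_le mu0 _ s0 => /(_ (- s)); rewrite oppr_lt0 HRe// => /(_ s0).
rewrite gerBl pmulr_rge0// subr_ge0; exact.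
Qed.

End forward.

(** For x > 0 and a < 0 the kernel is pointwise at most 1/x: the difference is (1 + x^2)(|z|^2 - ax)
    / (x |z - x|^2) >= 0. *)
Lemma Rintegral_nevRe_le tau gamma a b : tau `]-oo, 0]%classic = 0%E ->
  (\int[tau]_(x in [set x : R | (0 < x)%R]) ((x^-1)%R)%:E <= gamma%:E)%E ->
  a < 0 -> 0 < b -> Rintegral tau setT (nevRe a b) <= gamma.
Proof.
move=> tau0 Ig a0 b0; have In := integrable_nevRe tau a b0.
rewrite -lee_fin /Rintegral fineK; last exact: integrable_fin_num.
apply: le_trans Ig.
have mN : measurable (`]-oo, 0]%classic : set R) by exact: measurable_itv.
rewrite (negligible_integral mN measurableT In tau0).
have -> : [set: R] `\` `]-oo, 0]%classic = [set x : R | 0 < x].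
  by apply/seteqP; split=> x /=; rewrite in_itv/= ltNge; [move=> [_ /negP]|split=> //; exact/negP].
have mp := @measurable_pos R.
have [Iy|Iy] := eqVneq (\int[tau]_(x in [set x : R | (0 < x)%R]) ((x^-1)%R)%:E)%E +oo%E.
  by rewrite Iy leey.
apply: le_integral => //; first exact: (integrableS measurableT).
  apply/integrableP; split; first exact: measurable_invr_pos.
  rewrite ltey; apply: contra_neq Iy => <-; apply: eq_integral => x.
  by rewrite inE/= => x0; rewrite gtr0_norm// invr_gt0.
move=> x; rewrite inE/= => x0; rewrite lee_fin /nevRe ler_pdivrMr ?pker_den//.
rewrite [x^-1 * _]mulrC ler_pdivlMr//.
nra.
Qed.

Lemma boolean_semigroup_supp (mu : R -> probability R R) gamma tau :
  boolean_semigroup mu ->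
  (forall z : R[i], 0 < complex.Im z -> Kfun (mu 1) z
     = gamma%:C - cint tau (fun x => (1 + x%:C * z) / (x%:C - z))) ->
  ((exists t0 : R, 0 < t0 /\ supp (mu t0) `<=` [set x : R | 0 <= x])
   <-> (forall t : R, 0 <= t -> supp (mu t) `<=` [set x : R | 0 <= x])) /\
  ((forall t : R, 0 <= t -> supp (mu t) `<=` [set x : R | 0 <= x])
   <-> [/\ supp tau `<=` [set x : R | 0 <= x],
           tau [set 0] = 0%E,
           (\int[tau]_(x in [set x : R | (0 < x)%R]) ((x^-1)%R)%:E < +oo)%E &
           (\int[tau]_(x in [set x : R | (0 < x)%R]) ((x^-1)%R)%:E <= gamma%:E)%E]).
Proof.
move=> bs hK.
(* This and the next fact are H_t = z - t K_1 in real coordinates; the implications then run (1) =>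
   (3) => (2) => (1). *)
have KRe a b t : 0 < b -> 0 <= t -> complex.Re (Hfun (mu t) (a +i* b)) =
    a - t * (gamma - Rintegral tau setT (nevRe a b)).
  move=> b0 t0; have [+ _] := boolean_semigroup_linear bs a b0 t0.
  by rewrite hK// cint_nev {1}/Kfun; case: (Hfun (mu t) _) => u v /= h; lra.
have KIm a b t : 0 < b -> 0 <= t -> complex.Im (Hfun (mu t) (a +i* b)) =
    b + t * Rintegral tau setT (nevIm a b).
  move=> b0 t0; have [_ +] := boolean_semigroup_linear bs a b0 t0.
  by rewrite hK// cint_nev {1}/Kfun; case: (Hfun (mu t) _) => u v /= h; lra.
have P13 : (exists t0 : R, 0 < t0 /\ supp (mu t0) `<=` [set x : R | 0 <= x]) ->
    [/\ supp tau `<=` [set x : R | 0 <= x], tau [set 0] = 0%E,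
        (\int[tau]_(x in [set x : R | (0 < x)%R]) ((x^-1)%R)%:E < +oo)%E &
        (\int[tau]_(x in [set x : R | (0 < x)%R]) ((x^-1)%R)%:E <= gamma%:E)%E].
  move=> [t [t0 /supp_nonnegP mt]].
  have HR a b (b0 : 0 < b) := KRe a b t b0 (ltW t0).
  have HI a b (b0 : 0 < b) := KIm a b t b0 (ltW t0).
  have [? Ig] := integral_invr_le (nevanlinna_integral_le HR HI t0 mt).
  split=> //; last exact: le_lt_trans Ig (ltry _).
  by apply/supp_nonnegP; exact: (nevanlinna_null_neg HI t0 mt).
have P32 : [/\ supp tau `<=` [set x : R | 0 <= x], tau [set 0] = 0%E,
        (\int[tau]_(x in [set x : R | (0 < x)%R]) ((x^-1)%R)%:E < +oo)%E &
        (\int[tau]_(x in [set x : R | (0 < x)%R]) ((x^-1)%R)%:E <= gamma%:E)%E] ->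
    forall t : R, 0 <= t -> supp (mu t) `<=` [set x : R | 0 <= x].
  move=> [/supp_nonnegP tneg tz _ Ig] t t0.
  have tau0 : tau `]-oo, 0]%classic = 0%E.
    apply/eqP; rewrite -measure_le0.
    have -> : `]-oo, (0 : R)]%classic = `]-oo, 0[%classic `|` [set 0].
      by rewrite setUitv1.
    by rewrite (le_trans (measureU2 _ _ _))// [X in (X + _)%E]tneg [X in (_ + X)%E]tz adde0.
  apply/supp_nonnegP; apply: (@supp_boolean_of_nevanlinna _ (mu t) tau t gamma) => //.
  - by move=> a b b0; exact: KRe.
  - by move=> a b b0; exact: KIm.
  - by move=> a b a0 b0; exact: Rintegral_nevRe_le.
have P21 : (forall t : R, 0 <= t -> supp (mu t) `<=` [set x : R | 0 <= x]) ->
    exists t0 : R, 0 < t0 /\ supp (mu t0) `<=` [set x : R | 0 <= x].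
  by move=> h; exists 1; split=> //; exact: h.
split; split; eauto.
Qed.
End boolean_support.

(** * The semicircular free semigroup *)

Section density.
Context {R : realType}.
Local Notation leb := (@lebesgue_measure R).

(** [g] and the Radon-Nikodym derivative have the same integral over every measurable set, so they
    agree almost everywhere and the change of variables passes to [g]. *)
Lemma integral_density (nu : {finite_measure set (measurableTypeR R) -> \bar R}) (g : R -> R) :
  measurable_fun setT g -> (forall x, 0 <= g x) ->
  (forall A : set (measurableTypeR R), measurable A -> nu A = \int[leb]_(x in A) (g x)%:E)%E ->
  forall f : R -> \bar R, nu.-integrable setT f ->
  (\int[nu]_x f x = \int[leb]_x (f x * (g x)%:E))%E.
Proof.
move=> mg g0 nuE f If.
have mge : measurable_fun setT (fun x => (g x)%:E) by exact/measurable_EFinP.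
have dom : nu `<< leb.
  apply/null_content_dominatesP => A mA A0; rewrite nuE//.
  by apply: null_set_integral => //; exact: measurable_funTS.
have Ig : leb.-integrable setT (EFin \o g).
  apply/integrableP; split => //.
  under eq_integral do rewrite /= ger0_norm//.
  by rewrite -nuE// -ge0_fin_numE// fin_num_measure.
rewrite -(Radon_Nikodym_change_of_variables dom)//=.
have mf := measurable_int _ If.
have h : ae_eq leb setT (Radon_Nikodym (charge_of_finite_measure nu) leb) (EFin \o g).
  rewrite Radon_NikodymE/=.
  case: cid => /= h [h1 h2 h3]; apply: integral_ae_eq => //=.
  by move=> E E01 mE; rewrite -h3//; exact: nuE.
apply: ae_eq_integral => //; try exact: emeasurable_funM.
exact: ae_eqe_mul2l.
Qed.

End density.

(** * The law of the angle and orthogonality of sines *)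

Section angle_law.
Context {R : realType}.
Local Notation leb := (@lebesgue_measure R).
Implicit Types x u v : R.

Lemma sin_natpi (n : nat) : sin (n%:R * pi) = 0 :> R.
Proof.
elim: n => [|n ih]; first by rewrite mul0r sin0.
by rewrite -(@natr1 R) mulrDl mul1r sinDpi ih oppr0.
Qed.

Lemma continuous_integrable_0pi (f : R -> R) : continuous f ->
  leb.-integrable `[0, pi] (EFin \o f).
Proof.
move=> cf; apply: continuous_compact_integrable; first exact: segment_compact.
exact: continuous_subspaceT.
Qed.

Lemma continuous_cosM (n : nat) : continuous (fun x : R => cos (n%:R * x)).
Proof.
move=> x; apply: continuous_comp; last exact: continuous_cos.
by apply: cvgM; [exact: cvg_cst|exact: cvg_id].
Qed.

Lemma continuous_sinM (n : nat) : continuous (fun x : R => sin (n%:R * x)).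
Proof.
move=> x; apply: continuous_comp; last exact: continuous_sin.
by apply: cvgM; [exact: cvg_cst|exact: cvg_id].
Qed.

Lemma Rintegral_cosM (n : nat) :
  Rintegral leb `[0, pi]%classic (fun x => cos (n%:R * x)) =
  if n == 0 then pi else 0.
Proof.
case: n => [|n] /=.
  under eq_Rintegral do rewrite mul0r cos0.
  rewrite Rintegral_cst//= mul1r lebesgue_measure_itv/= lte_fin pi_gt0.
  by rewrite oppr0 addr0.
rewrite /Rintegral (@continuous_FTC2 _ _ (fun x => n.+1%:R^-1 * sin (n.+1%:R * x))).
- by rewrite mulr0 sin0 sin_natpi mulr0 sube0.
- exact: pi_gt0.
- exact/continuous_subspaceT/continuous_cosM.
- have cF : continuous (fun x : R => n.+1%:R^-1 * sin (n.+1%:R * x)).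
    by move=> x; apply: cvgM; [exact: cvg_cst|exact: continuous_sinM].
  split.
  + by move=> x _; apply: ex_derive.
  + exact/cvg_at_right_filter/cF.
  + exact/cvg_at_left_filter/cF.
- move=> x _; rewrite derive1E.
  by rewrite derive_val /GRing.scale/= mulr1 mulrC -mulrA mulfV ?mulr1.
Qed.

Lemma Rintegral_sin_sinM (n : nat) :
  Rintegral leb `[0, pi]%classic (fun x => sin x * sin (n.+1%:R * x)) =
  if n == 0 then pi / 2 else 0.
Proof.
have E x : sin x * sin (n.+1%:R * x) =
    2^-1 * (cos (n%:R * x) - cos (n.+2%:R * x)).
  have -> : n%:R * x = n.+1%:R * x - x by rewrite -(@natr1 R n); ring.
  have -> : n.+2%:R * x = n.+1%:R * x + x by rewrite -(@natr1 R n.+1); ring.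
  by rewrite cosB cosD; field.
have Ic k : leb.-integrable `[0, pi] (EFin \o (fun x => cos (k%:R * x))).
  exact/continuous_integrable_0pi/continuous_cosM.
under eq_Rintegral do rewrite E.
rewrite RintegralZl//; last first.
  apply: continuous_integrable_0pi => x.
  by apply: cvgB; exact: continuous_cosM.
rewrite RintegralB// !Rintegral_cosM/= subr0.
by case: eqP => _; rewrite ?mulr0// mulrC.
Qed.

(** The image of this law under 2 cos x is the standard semicircle law; on the angle side all
    integrals are trigonometric. *)
Definition angle_pdf : R -> R :=
  (fun x => 2 / pi * sin x ^+ 2) \_ `[0, pi]%classic.

Lemma angle_pdf_ge0 x : 0 <= angle_pdf x.
Proof.
rewrite /angle_pdf patchE; case: ifP => // _.
by rewrite mulr_ge0 ?sqr_ge0// divr_ge0// pi_ge0.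
Qed.

Lemma continuous_sin2 : continuous (fun x : R => 2 / pi * sin x ^+ 2).
Proof.
move=> x; apply: cvgM; first exact: cvg_cst.
by apply: cvgM; exact: continuous_sin.
Qed.

Lemma measurable_angle_pdf : measurable_fun setT angle_pdf.
Proof.
apply/measurable_restrict => //; rewrite setTI.
apply: measurable_funTS; apply: continuous_measurable_fun.
exact: continuous_sin2.
Qed.

Lemma Rintegral_angle_pdf :
  Rintegral leb `[0, pi]%classic (fun x => 2 / pi * sin x ^+ 2) = 1.
Proof.
rewrite RintegralZl//; last first.
  apply: continuous_integrable_0pi => x.
  by apply: cvgM; exact: continuous_sin.
have := Rintegral_sin_sinM 0.
under [in X in X -> _]eq_Rintegral do rewrite mul1r -expr2.
have p0 : pi != 0 :> R by rewrite gt_eqF ?pi_gt0.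
by move=> ->; rewrite eqxx; move: (pi : R) p0 => p p0; field.
Qed.

Definition angle_law (A : set (measurableTypeR R)) : \bar R :=
  (\int[leb]_(x in A) (angle_pdf x)%:E)%E.

Let angle_law0 : angle_law set0 = 0%E.
Proof. exact: integral_set0. Qed.

Let angle_law_ge0 A : (0 <= angle_law A)%E.
Proof. by apply: integral_ge0 => x _; rewrite lee_fin angle_pdf_ge0. Qed.

Let angle_law_sigma_additive : semi_sigma_additive angle_law.
Proof.
move=> F mF tF mUF; rewrite /angle_law; apply: cvg_toP.
  apply: ereal_nondecreasing_is_cvgn => m n mn.
  apply: lee_sum_nneg_natr => // k _ _.
  by apply: integral_ge0 => x _; rewrite lee_fin angle_pdf_ge0.
rewrite ge0_integral_bigcup//=.
- by apply/measurable_funTS/measurable_EFinP; exact: measurable_angle_pdf.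
- by move=> x _; rewrite lee_fin angle_pdf_ge0.
Qed.

HB.instance Definition _ := isMeasure.Build _ _ _ angle_law
  angle_law0 angle_law_ge0 angle_law_sigma_additive.

Let angle_lawT : angle_law setT = 1%E.
Proof.
transitivity (\int[leb]_(x in `[0%R, pi]) (2 / pi * sin x ^+ 2)%R%:E)%E.
  rewrite /angle_law [RHS]integral_mkcond; apply: eq_integral => x _.
  by rewrite /angle_pdf !patchE; case: ifP.
rewrite -[in RHS]Rintegral_angle_pdf /Rintegral fineK//.
apply: integrable_fin_num => //.
exact/continuous_integrable_0pi/continuous_sin2.
Qed.

HB.instance Definition _ :=
  @Measure_isProbability.Build _ _ R angle_law angle_lawT.

Lemma Rintegral_angle_law (f : R -> R) : continuous f ->
  (exists C : R, forall x, `|f x| <= C) ->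
  Rintegral angle_law setT f =
  Rintegral leb `[0, pi]%classic (fun x => f x * (2 / pi * sin x ^+ 2)).
Proof.
move=> cf [C fC]; rewrite /Rintegral.
rewrite (@integral_density _ angle_law angle_pdf)//.
- rewrite [in RHS]integral_mkcond; congr fine; apply: eq_integral => x _.
  rewrite /angle_pdf !patchE; case: ifP => // _; last by rewrite mule0.
- exact: measurable_angle_pdf.
- exact: angle_pdf_ge0.
- apply: (@bounded_integrable _ _ _ angle_law f C) => //.
  exact: continuous_measurable_fun.
Qed.

End angle_law.

(** * A generating function for sines *)

Section kernel_identity.
Context {R : realType}.
Local Notation leb := (@lebesgue_measure R).
Local Notation normc := (@ComplexField.Normc.normc R).
Implicit Types (q z : R[i]) (x : R).

(** Denominator of the generating function of the Chebyshev polynomials of the second kind: for |q|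
    < 1, the series of q^k sin((k + 1) x) sums to sin x / [cden q x]. *)
Definition cden q x : R[i] := 1 - 2 * q * (cos x)%:C + q ^+ 2.

Definition sin_sum q (N : nat) x : R[i] :=
  \sum_(k < N) q ^+ k * (sin (k.+1%:R * x))%:C.

(** Induction on N by the recurrence sin((N + 2) x) = 2 cos x sin((N + 1) x) - sin(N x). *)
Lemma cden_sin_sum q N x : cden q x * sin_sum q N x =
  (sin x)%:C - q ^+ N * (sin (N.+1%:R * x))%:C
  + q ^+ N.+1 * (sin (N%:R * x))%:C.
Proof.
elim: N => [|N ih].
  by rewrite /sin_sum big_ord0 mulr0 expr0 !mul1r subrr mul0r sin0 add0r mulr0.
rewrite /sin_sum big_ord_recr/= -/(sin_sum q N x) mulrDr ih.
have E : (sin (N.+2%:R * x))%:C =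
    2 * (cos x)%:C * (sin (N.+1%:R * x))%:C - (sin (N%:R * x))%:C :> R[i].
  have -> : N.+2%:R * x = N.+1%:R * x + x by rewrite -(@natr1 R N.+1); ring.
  have -> : N%:R * x = N.+1%:R * x - x by rewrite -(@natr1 R N); ring.
  by rewrite sinD sinB !rmorphD rmorphN !rmorphM/=; ring.
by rewrite E /cden !exprS; ring.
Qed.

Lemma normc_ge0 z : 0 <= normc z.
Proof. by case: z => x y; exact: sqrtr_ge0. Qed.

Lemma normc_pos z : z != 0 -> 0 < normc z.
Proof.
move=> z0; rewrite lt_neqAle normc_ge0 andbT eq_sym; apply: contra z0 => /eqP.
by move=> /ComplexField.Normc.eq0_normc ->.
Qed.

Lemma normc_1B z : 1 - normc z <= normc (1 - z).
Proof.
rewrite lerBlDr -[leLHS](@ComplexField.Normc.normc1 R).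
by rewrite -[X in normc X](subrK z); exact: le_normcD.
Qed.

Lemma normcX z n : normc (z ^+ n) = normc z ^+ n.
Proof.
elim: n => [|n ih]; first by rewrite !expr0 ComplexField.Normc.normc1.
by rewrite !exprS ComplexField.Normc.normcM ih.
Qed.

Lemma normc_real x : normc x%:C = `|x|.
Proof. by rewrite /= expr0n addr0 sqrtr_sqr. Qed.

(** The denominator factors as (1 - q e^(ix)) (1 - q e^(-ix)), and each factor has modulus at least
    1 - |q|. *)
Lemma normc_cden_ge q x : normc q < 1 -> (1 - normc q) ^+ 2 <= normc (cden q x).
Proof.
move=> q1; pose e : R[i] := cos x +i* sin x; pose e' : R[i] := cos x +i* (- sin x).
have ne : normc e = 1 by rewrite /= cos2Dsin2 sqrtr1.
have ne' : normc e' = 1 by rewrite /= sqrrN cos2Dsin2 sqrtr1.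
have ee : e * e' = 1.
  rewrite /e /e'; simpc; rewrite -!expr2 cos2Dsin2.
  by congr (_ +i* _); ring.
have eD : e + e' = 2 * (cos x)%:C.
  rewrite mulr_natl mulr2n -[LHS]/((cos x + cos x) +i* (sin x - sin x)).
  by rewrite -[RHS]/((cos x + cos x) +i* (0 + 0)) subrr addr0.
have -> : cden q x = (1 - q * e) * (1 - q * e').
  rewrite /cden; transitivity (1 - q * (e + e') + q ^+ 2 * (e * e')); last by ring.
  by rewrite ee eD; ring.
rewrite ComplexField.Normc.normcM expr2.
have h w : normc w = 1 -> 1 - normc q <= normc (1 - q * w).
  by move=> w1; apply: le_trans (normc_1B _); rewrite ComplexField.Normc.normcM w1 mulr1.
by apply: ler_pM; rewrite ?h// subr_ge0 ltW.
Qed.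

Lemma cden_neq0 q x : normc q < 1 -> cden q x != 0.
Proof.
move=> q1; apply: contraTneq (normc_cden_ge x q1) => ->.
by rewrite ComplexField.Normc.normc0 -ltNge exprn_gt0// subr_gt0.
Qed.

Lemma normc_ge_ReIm z : `|complex.Re z| <= normc z /\ `|complex.Im z| <= normc z.
Proof.
by case: z => a b /=; rewrite -!sqrtr_sqr !ler_wsqrtr// ?lerDl ?lerDr ?sqr_ge0.
Qed.

(* Real and imaginary parts are integrated simultaneously through [rlin a b]. *)
Definition rlin (a b : R) z := a * complex.Re z + b * complex.Im z.

Lemma rlinD a b : {morph rlin a b : z w / z + w}.
Proof. by move=> [z1 z2] [w1 w2]; rewrite /rlin /=; ring. Qed.

Lemma rlinB a b : {morph rlin a b : z w / z - w}.
Proof. by move=> [z1 z2] [w1 w2]; rewrite /rlin /=; ring. Qed.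

Lemma rlinZ a b x z : rlin a b (x%:C * z) = x * rlin a b z.
Proof. by case: z => z1 z2; rewrite /rlin /=; ring. Qed.

Lemma normr_rlin_le a b z : `|rlin a b z| <= (`|a| + `|b|) * normc z.
Proof.
rewrite (le_trans (ler_normD _ _))// !normrM mulrDl.
by have [? ?] := normc_ge_ReIm z; apply: lerD; exact: ler_wpM2l.
Qed.

Lemma continuous_rlin_cdenV a b q : normc q < 1 ->
  continuous (fun x : R => rlin a b (cden q x)^-1).
Proof.
move=> q1; case: q q1 => u v q1.
pose dr x := 1 - 2 * u * cos x + (u ^+ 2 - v ^+ 2).
pose di x := - 2 * v * cos x + 2 * u * v.
have DE x : cden (u +i* v) x = dr x +i* di x.
  rewrite /cden expr2 mulr_natl mulr2n; apply/eqP; rewrite eq_complex /=.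
  by apply/andP; split; apply/eqP; rewrite /dr /di; ring.
have cdr : continuous dr.
  move=> x; apply: cvgD; last exact: cvg_cst.
  apply: cvgB; first exact: cvg_cst.
  by apply: cvgM; [exact: cvg_cst|exact: continuous_cos].
have cdi : continuous di.
  move=> x; apply: cvgD; last exact: cvg_cst.
  by apply: cvgM; [exact: cvg_cst|exact: continuous_cos].
have d0 x : dr x ^+ 2 + di x ^+ 2 != 0.
  have := cden_neq0 x q1; rewrite DE eq_complex /=.
  by move: (dr x) (di x) => d e h; rewrite paddr_eq0 ?sqr_ge0// !expf_eq0.
have -> : (fun x => rlin a b (cden (u +i* v) x)^-1) =
    (fun x => (a * dr x - b * di x) / (dr x ^+ 2 + di x ^+ 2)).
  apply/funext => x; rewrite DE /rlin /=; ring.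
move=> x; apply: cvgM.
  by apply: cvgB; (apply: cvgM; [exact: cvg_cst|]); [exact: cdr|exact: cdi].
apply: cvgV; first exact: d0.
by apply: cvgD; apply: cvgM; do ?[exact: cdr|exact: cdi].
Qed.

Lemma rlin_cdenV_bounded a b q : normc q < 1 ->
  forall x, `|rlin a b (cden q x)^-1| <= (`|a| + `|b|) / (1 - normc q) ^+ 2.
Proof.
move=> q1 x; rewrite (le_trans (normr_rlin_le _ _ _))//.
apply: ler_wpM2l; first by rewrite addr_ge0.
have r0 : 0 < (1 - normc q) ^+ 2 by rewrite exprn_gt0// subr_gt0.
rewrite ComplexField.Normc.normcV lef_pV2 ?posrE//; first exact: normc_cden_ge.
exact: lt_le_trans r0 (normc_cden_ge _ q1).
Qed.

Lemma le0_of_geometric (y C r : R) : 0 <= r < 1 ->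
  (forall N, y <= C * r ^+ N) -> y <= 0.
Proof.
move=> /andP[r0 r1] H; have cC : C * r ^+ N @[N --> \oo] --> (0 : R).
  rewrite -[X in _ --> X](mulr0 C); apply: cvgM; first exact: cvg_cst.
  by apply: cvg_expr; rewrite ger0_norm.
rewrite -(cvg_lim (@Rhausdorff R) cC); apply: limr_ge; first by apply/cvg_ex; exists 0.
by apply: nearW => N; exact: H.
Qed.

(** Against the density, 1 / [cden] becomes (2 / pi) sin x times the series of q^k sin((k + 1) x).
    By orthogonality only k = 0 survives, so the complex integral is 1, and [rlin a b 1] is a. *)
Lemma Rintegral_cdenV a b q : normc q < 1 ->
  Rintegral (@angle_law R) setT (fun x => rlin a b (cden q x)^-1) = a.
Proof.
move=> q1; have cf := @continuous_rlin_cdenV a b q q1.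
rewrite Rintegral_angle_law//; last first.
  by exists ((`|a| + `|b|) / (1 - normc q) ^+ 2); exact: rlin_cdenV_bounded.
pose P N x := 2 / pi * (sin x * rlin a b (sin_sum q N x)).
have cS N x0 : {for x0, continuous (fun x => sin x * sin (N.+1%:R * x))}.
  by apply: cvgM; [exact: continuous_sin|exact: continuous_sinM].
have PS N x : P N.+1 x = P N x +
    2 / pi * rlin a b (q ^+ N) * (sin x * sin (N.+1%:R * x)).
  rewrite /P /sin_sum big_ord_recr/= -/(sin_sum q N x) rlinD [q ^+ N * _]mulrC rlinZ.
  by move: (2 / pi) (rlin a b _) => c d; ring.
have cP N : continuous (P N).
  elim: N => [|N ih].
    have -> : P 0 = fun=> 0.
      by apply/funext => x; rewrite /P /sin_sum big_ord0 /rlin /= !mulr0 addr0 !mulr0.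
    by move=> x; exact: cvg_cst.
  rewrite (funext (PS N)) => x; apply: cvgD; first exact: ih.
  by apply: cvgM; [exact: cvg_cst|exact: cS].
(* The index starts at 1 because [P 0] is the empty sum; every later term integrates to 0. *)
have IP N : Rintegral leb `[0, pi]%classic (P N.+1) = a.
  elim: N => [|N ih].
    rewrite (_ : P 1 = fun x => 2 / pi * a * (sin x * sin (1%:R * x))).
      rewrite RintegralZl//; last exact/continuous_integrable_0pi/(cS 0).
      rewrite (Rintegral_sin_sinM 0) eqxx.
      have : pi != 0 :> R by rewrite gt_eqF ?pi_gt0.
      by move: (pi : R) => p p0; field.
    apply/funext => x; rewrite PS expr0 {1}/P /sin_sum big_ord0.
    by rewrite {1 2}/rlin /= !mulr0 addr0 !mulr0 add0r mulr1 addr0.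
  rewrite (funext (PS N.+1)) RintegralD//; last 2 first.
  - exact/continuous_integrable_0pi/cP.
  - apply: continuous_integrable_0pi => x.
    by apply: cvgM; [exact: cvg_cst|exact: cS].
  rewrite ih RintegralZl//; last exact/continuous_integrable_0pi/cS.
  by rewrite Rintegral_sin_sinM/= mulr0 addr0.
set f := (fun x => _ * _).
have cf' : continuous f by move=> x; apply: cvgM; [exact: cf|exact: continuous_sin2].
set r := normc q in q1.
have r0 : 0 <= r by exact: normc_ge0.
have p0 : 0 < (2 / pi : R) by rewrite divr_gt0// pi_gt0.
have rr : 0 < (1 - r) ^+ 2 by rewrite exprn_gt0// subr_gt0.
(* The truncation error has two terms of modulus at most r^N over a denominator of modulus at least
   (1 - r)^2. *)
pose C := 2 / pi * ((`|a| + `|b|) * (2 / (1 - r) ^+ 2)).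
have fP N x : `|f x - P N x| <= C * r ^+ N.
  have -> : f x - P N x = 2 / pi * (sin x * rlin a b
      ((q ^+ N * (sin (N.+1%:R * x))%:C - q ^+ N.+1 * (sin (N%:R * x))%:C) / cden q x)).
    have -> : q ^+ N * (sin (N.+1%:R * x))%:C - q ^+ N.+1 * (sin (N%:R * x))%:C =
        (sin x)%:C - cden q x * sin_sum q N x by rewrite cden_sin_sum; ring.
    rewrite mulrBl [cden q x * _]mulrC mulfK ?cden_neq0// rlinB rlinZ /f /P.
    by move: (2 / pi) (rlin a b _) (rlin a b _) => c d e; ring.
  have -> : C * r ^+ N =
      2 / pi * ((`|a| + `|b|) * (2 / (1 - r) ^+ 2 * r ^+ N)) by rewrite /C !mulrA.
  rewrite normrM (gtr0_norm p0) normrM; apply: ler_wpM2l; first exact: ltW.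
  have s1 y : `|sin y| <= 1 :> R by rewrite ler_norml sin_geN1 sin_le1.
  apply: (@le_trans _ _ (1 * ((`|a| + `|b|) * (2 / (1 - r) ^+ 2 * r ^+ N)))); last first.
    by rewrite mul1r.
  apply: ler_pM => //; rewrite (le_trans (normr_rlin_le _ _ _))//.
  apply: ler_wpM2l; first by rewrite addr_ge0.
  rewrite ComplexField.Normc.normcM ComplexField.Normc.normcV mulrAC.
  apply: ler_pM; rewrite ?normc_ge0 ?invr_ge0 ?normc_ge0//.
    rewrite (le_trans (le_normcD _ _))// normcN !ComplexField.Normc.normcM.
    rewrite !normc_real !normcX -/r mulr2n mulrDl !mul1r exprS.
    have rN : 0 <= r ^+ N by rewrite exprn_ge0.
    apply: lerD; first by rewrite ler_piMr.
    rewrite -mulrA; apply: (@le_trans _ _ (r ^+ N * `|sin (N%:R * x)|)).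
      by apply: ler_piMl; [exact: mulr_ge0|exact: ltW].
    by rewrite ler_piMr.
  rewrite lef_pV2 ?posrE//; first exact: normc_cden_ge.
  exact: lt_le_trans rr (normc_cden_ge _ q1).
have key N : `|Rintegral leb `[0, pi]%classic f - a| <= C * pi * r * r ^+ N.
  have If := continuous_integrable_0pi cf'.
  have IPN := continuous_integrable_0pi (cP N.+1).
  rewrite -{1}(IP N) -RintegralB//.
  have cB : continuous (fun x => f x - P N.+1 x).
    by move=> x; apply: cvgB; [exact: cf'|exact: cP].
  have IB := continuous_integrable_0pi cB.
  apply: (le_trans (le_normr_Rintegral _ IB)) => //.
  have Ic : leb.-integrable `[0, pi] (EFin \o (fun _ : R => C * r ^+ N.+1)).
    by apply: continuous_integrable_0pi => x; exact: cvg_cst.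
  apply: (@le_trans _ _ (Rintegral leb `[0, pi]%classic (fun=> C * r ^+ N.+1))).
    apply: le_Rintegral => //.
    apply: continuous_integrable_0pi => x; apply: cvg_norm.
    exact: cB.
  rewrite Rintegral_cst//= lebesgue_measure_itv/= lte_fin pi_gt0/=.
  by rewrite oppr0 addr0 exprS le_eqVlt; apply/orP; left; apply/eqP; ring.
apply/eqP; rewrite -subr_eq0 -normr_le0.
by apply: (@le0_of_geometric _ (C * pi * r) r) => //; rewrite r0.
Qed.

End kernel_identity.

(** * The semicircle laws and their Cauchy transforms *)

Section semicircle.
Context {R : realType}.
Local Notation leb := (@lebesgue_measure R).
Local Notation normc := (@ComplexField.Normc.normc R).
Implicit Types (z : R[i]) (x t : R).

(** The mean 2t is written through the square root, so that time enters only as a polynomial in sqrt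
    t. *)
Definition semicircle_rv t (x : measurableTypeR R) : R :=
  2 * Num.sqrt t ^+ 2 + 2 * Num.sqrt t * cos x.

Lemma continuous_semicircle_rv t : continuous (semicircle_rv t : R -> R).
Proof.
move=> x; apply: cvgD; first exact: cvg_cst.
by apply: cvgM; [exact: cvg_cst|exact: continuous_cos].
Qed.

Lemma measurable_semicircle_rv t : measurable_fun setT (semicircle_rv t).
Proof.
have := @continuous_measurable_fun R _ (@continuous_semicircle_rv t).
exact.
Qed.

HB.instance Definition _ t :=
  isMeasurableFun.Build _ _ _ _ (semicircle_rv t) (measurable_semicircle_rv t).

Definition semicircle t : probability R R :=
  distribution (@angle_law R) (semicircle_rv t).

Lemma Rintegral_semicircle t (f : R -> R) : continuous f ->
  (exists C : R, forall x, `|f x| <= C) ->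
  Rintegral (semicircle t) setT f =
  Rintegral (@angle_law R) setT (fun x => f (semicircle_rv t x)).
Proof.
move=> cf [C fC]; congr fine.
apply: (@integral_distribution _ _ _ _ _ (@angle_law R) (semicircle_rv t) (EFin \o f)).
  by apply/measurable_EFinP; exact: continuous_measurable_fun.
apply: (@bounded_integrable _ _ _ (@angle_law R) (f \o semicircle_rv t) C) => //.
  apply: continuous_measurable_fun => x; apply: continuous_comp; last exact: cf.
  exact: continuous_semicircle_rv.
by move=> x; exact: fC.
Qed.

(** In the variable s = sqrt t the integrand is continuous and dominated by the constant 2C / pi, so
    continuity passes under the integral; then compose with the square root. *)
Lemma weakly_continuous_semicircle : weakly_continuous semicircle.
Proof.
move=> f cf fb t0 t0_ge0 e e0; have [C fC] := fb.
pose g s x := f (2 * s ^+ 2 + 2 * s * cos x) * (2 / pi * sin x ^+ 2).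
pose G s := Rintegral leb `[0, pi]%classic (g s).
have GE t : Rintegral (semicircle t) setT f = G (Num.sqrt t).
  rewrite Rintegral_semicircle// Rintegral_angle_law//.
    move=> x; apply: continuous_comp; last exact: cf.
    exact: continuous_semicircle_rv.
  by exists C => x; exact: fC.
have cgx s : continuous (g s).
  move=> x; apply: cvgM; last exact: continuous_sin2.
  apply: (@continuous_comp _ _ _ (fun x => 2 * s ^+ 2 + 2 * s * cos x) f).
    apply: cvgD; first exact: cvg_cst.
    by apply: cvgM; [exact: cvg_cst|exact: continuous_cos].
  exact: cf.
have cgs x : continuous (g ^~ x).
  have ci : continuous (fun s : R => 2 * s ^+ 2 + 2 * s * cos x).
    move=> s; apply: cvgD.
      by apply: cvgM; [exact: cvg_cst|apply: cvgM; exact: cvg_id].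
    by apply: cvgM; [apply: cvgM; [exact: cvg_cst|exact: cvg_id]|exact: cvg_cst].
  move=> s; apply: cvgM; last exact: cvg_cst.
  exact: (@continuous_comp _ _ _ _ f s (ci s) (cf _)).
have cG s : {for s, continuous G}.
  have := @continuity_under_integral R _ _ leb g `[0, pi]%classic
    (measurable_itv _) (s - 1) (s + 1) _ _ (fun=> C * (2 / pi)).
  move=> H; apply: H.
  - by move=> y _; exact: continuous_integrable_0pi.
  - by apply: aeW => x _ y _; exact: cgs.
  - by apply: continuous_integrable_0pi => x; exact: cvg_cst.
  - move=> y _; apply: aeW => x _; rewrite /g normrM.
    apply: ler_pM => //; have p0 : 0 < 2 / pi :> R by rewrite divr_gt0// pi_gt0.
    rewrite normrM (gtr0_norm p0) ler_piMr ?(ltW p0)// ger0_norm ?sqr_ge0//.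
  - by rewrite inE/= in_itv/=; lra.
have cGs : {for t0, continuous (fun t => G (Num.sqrt t))}.
  apply: (@continuous_comp _ _ _ (@Num.sqrt R) G); last exact: cG.
  exact: sqrt_continuous.
have /cvgrPdist_lt/(_ e e0) := cGs; move=> /nbhs_ballP[d /= d0 dG].
exists d; split=> // t t_ge0 td; rewrite !GE distrC; apply: dG.
by rewrite /ball/= distrC.
Qed.

(** This is z + phi(z), where phi(z) = 2t + t/z is the Voiculescu transform of the semicircle law of
    mean 2t and variance t. *)
Definition Finv t z : R[i] := z + (2 * t)%:C + t%:C / z.

Lemma cabsE z : cabs z = normc z. Proof. by case: z. Qed.

(** Put q = sqrt t / z, so that |q| < 1. Subtracting the random variable from [Finv t z] leaves z
    times [cden q x], and 1 / [cden q x] has mean 1. *)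
Lemma cauchyG_semicircle t z : 0 <= t -> 0 < complex.Im (Finv t z) ->
  t < normc z ^+ 2 -> cauchyG (semicircle t) (Finv t z) = z^-1.
Proof.
move=> t0; set w := Finv t z => w0 tz.
have z0 : z != 0.
  by apply: contraTneq tz => ->; rewrite ComplexField.Normc.normc0 expr0n/= ltNge t0.
have nz := normc_pos z0.
pose q : R[i] := (Num.sqrt t)%:C / z.
have q1 : normc q < 1.
  rewrite /q ComplexField.Normc.normcM ComplexField.Normc.normcV normc_real.
  rewrite ger0_norm ?sqrtr_ge0// ltr_pdivrMr// mul1r.
  by rewrite -(ltr_pXn2r (n := 2)) ?nnegrE ?sqrtr_ge0 ?normc_ge0// sqr_sqrtr.
have E x : (w - (semicircle_rv t x)%:C)^-1 = z^-1 * (cden q x)^-1.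
  rewrite -invfM; congr (_^-1); rewrite /w /Finv /cden /semicircle_rv.
  have -> : t%:C = (Num.sqrt t)%:C ^+ 2 :> R[i] by rewrite -rmorphXn/= sqr_sqrtr.
  rewrite sqr_sqrtr// /q.
  have -> : (2 * t + 2 * Num.sqrt t * cos x)%:C =
      (2 * t)%:C + 2 * (Num.sqrt t)%:C * (cos x)%:C :> R[i].
    by rewrite rmorphD/=; congr (_ + _); rewrite !rmorphM/= rmorph_nat.
  by move: (Num.sqrt t)%:C (cos x)%:C (2 * t)%:C => s c d; field.
have wE : w = complex.Re w +i* complex.Im w by case: (w).
set a := complex.Re w in wE; set b := complex.Im w in wE w0.
have EF x : (w - x%:C)^-1 = ((a - x) * pker a b x) +i* (- b * pker a b x).
  rewrite wE -[LHS]/(((a - x) / ((a - x) ^+ 2 + (b - 0) ^+ 2)) +i*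
    (- ((b - 0) / ((a - x) ^+ 2 + (b - 0) ^+ 2)))).
  by rewrite subr0 mulNr.
rewrite /cauchyG /cint.
have -> : Rintegral (semicircle t) setT (fun x => complex.Re (w - x%:C)^-1) =
    complex.Re z^-1.
  have -> : (fun x => complex.Re (w - x%:C)^-1) = (fun x => (a - x) * pker a b x).
    by apply/funext => x; rewrite EF.
  rewrite Rintegral_semicircle.
  (* The real part of a product c/z is [rlin] of c with coefficients Re(1/z) and -Im(1/z); below,
     the imaginary part uses Im(1/z) and Re(1/z). *)
  - rewrite -[RHS](@Rintegral_cdenV _ _ (- complex.Im z^-1) _ q1).
    apply: eq_Rintegral => x _; have := E x; rewrite EF => /(congr1 (@complex.Re R)) /= ->.
    by case: (z^-1) => u v; case: (_^-1) => u' v'; rewrite /rlin /=; ring.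
  - move=> x; apply: cvgM; last exact: continuous_pker.
    by apply: cvgB; [exact: cvg_cst|exact: cvg_id].
  - by exists b^-1 => x; exact: pker1_le.
have -> : Rintegral (semicircle t) setT (fun x => complex.Im (w - x%:C)^-1) =
    complex.Im z^-1.
  have -> : (fun x => complex.Im (w - x%:C)^-1) = (fun x => - b * pker a b x).
    by apply/funext => x; rewrite EF.
  rewrite Rintegral_semicircle.
  - rewrite -[RHS](@Rintegral_cdenV _ _ (complex.Re z^-1) _ q1).
    apply: eq_Rintegral => x _; have := E x; rewrite EF => /(congr1 (@complex.Im R)) /= ->.
    by case: (z^-1) => u v; case: (_^-1) => u' v'; rewrite /rlin /=; ring.
  - by move=> x; apply: cvgM; [exact: cvg_cst|exact: continuous_pker].
  - exists (`|b| * (b ^+ 2)^-1) => x; rewrite normrM normrN.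
    by rewrite (gtr0_norm (pker_gt0 _ _ w0)); apply: ler_wpM2l => //; exact: pker_le.
by rewrite -complexE.
Qed.

End semicircle.

(** * The free semigroup and the failure of positivity at small times *)

Section free_semigroup.
Context {R : realType}.
Local Notation normc := (@ComplexField.Normc.normc R).
Implicit Types (z w h : R[i]) (x t M : R).

Lemma normc_sqr z : normc z ^+ 2 = complex.Re z ^+ 2 + complex.Im z ^+ 2.
Proof. by case: z => a b /=; rewrite sqr_sqrtr// addr_ge0 ?sqr_ge0. Qed.

Lemma Im_Finv t z : complex.Im (Finv t z) = complex.Im z * (1 - t / normc z ^+ 2).
Proof. by rewrite normc_sqr /Finv; case: z => a b /=; ring. Qed.

Lemma Re_Finv t z :
  complex.Re (Finv t z) = complex.Re z * (1 + t / normc z ^+ 2) + 2 * t.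
Proof. by rewrite normc_sqr /Finv; case: z => a b /=; ring. Qed.

Lemma Im_Finv_gt0 t z : 0 <= t -> 0 < complex.Im z -> t < normc z ^+ 2 ->
  0 < complex.Im (Finv t z).
Proof.
move=> t0 z0 tz; rewrite Im_Finv mulr_gt0// subr_gt0 ltr_pdivrMr ?mul1r//.
exact: le_lt_trans tz.
Qed.

Lemma Hfun_semicircle t z : 0 <= t -> 0 < complex.Im z -> t < normc z ^+ 2 ->
  Hfun (semicircle t) (Finv t z) = z.
Proof.
by move=> t0 z0 tz; rewrite /Hfun cauchyG_semicircle ?invrK// Im_Finv_gt0.
Qed.

(** The difference quotient deviates from 1 - t / z0^2 by exactly t h / (z0^2 (z0 + h)). *)
Lemma holomorphic_Finv t M : 0 <= t -> 0 <= M -> holomorphic_on (cone 1 M) (Finv t).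
Proof.
move=> t0 M0 z0 [_ Mz].
have z00 : z0 != 0 by apply: contraTneq Mz => -> /=; rewrite -leNgt.
have n0 := normc_pos z00.
exists (1 - t%:C / z0 ^+ 2) => e e0.
(* The first bound keeps |z0 + h| >= |z0| / 2, the second makes t |h| < e |z0|^3 / 2; t + 1 avoids
   dividing by zero at t = 0. *)
pose d := Num.min (normc z0 / 2) (e * normc z0 ^+ 3 / (2 * (t + 1))).
have d0 : 0 < d.
  rewrite lt_min !divr_gt0 ?mulr_gt0 ?exprn_gt0//.
  by rewrite ltr_wpDl.
exists d; split=> // h h0; rewrite !cabsE lt_min => /andP[h1 h2].
have zh : normc z0 / 2 <= normc (z0 + h).
  have := le_normcD (z0 + h) (- h); rewrite addrK normcN => hh.
  by rewrite -(lerD2r (normc h)); lra.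
have zh_gt0 : 0 < normc (z0 + h) by apply: lt_le_trans zh; rewrite divr_gt0.
have zh0 : z0 + h != 0.
  by apply: contraTneq zh_gt0 => ->; rewrite ComplexField.Normc.normc0 ltxx.
have -> : (Finv t (z0 + h) - Finv t z0) / h - (1 - t%:C / z0 ^+ 2) =
    t%:C * h / (z0 ^+ 2 * (z0 + h)).
  by rewrite /Finv; move: (2 * t)%:C t%:C => c c'; field; rewrite h0 z00 zh0.
rewrite !(ComplexField.Normc.normcM, ComplexField.Normc.normcV, normcX).
rewrite normc_real ger0_norm// ltr_pdivrMr ?mulr_gt0// ?exprn_gt0//.
apply: (@lt_le_trans _ _ (e * (normc z0 ^+ 2 * (normc z0 / 2)))); last first.
  by do 2! (apply: ler_wpM2l; first by rewrite ?exprn_ge0 ?ltW).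
move: h2; rewrite ltr_pdivlMr ?mulr_gt0// ?ltr_wpDl// => h2.
have := normc_ge0 h; rewrite le_eqVlt => /orP[/eqP <-|hp].
  by rewrite mulr0 !mulr_gt0// ?exprn_gt0// ?invr_gt0.
have -> : e * (normc z0 ^+ 2 * (normc z0 / 2)) = e * normc z0 ^+ 3 / 2 by field.
by rewrite ltr_pdivlMr//; move: h2; move: (e * _) => c; nra.
Qed.

Lemma Finv_right_inverse t M : 0 <= t -> t < M -> 1 < M ->
  H_right_inverse (semicircle t) 1 M (Finv t).
Proof.
move=> t0 tM M1.
have cz z : cone 1 M z -> [/\ 0 < complex.Im z, M < normc z & t < normc z ^+ 2].
  move=> [_ Mz]; have z0 : 0 < complex.Im z by lra.
  have [_ hz] := normc_ge_ReIm z; rewrite (gtr0_norm z0) in hz.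
  have Mn : M < normc z by lra.
  split=> //; apply: (lt_trans tM); rewrite expr2; nra.
split => //; first lra.
- by apply: holomorphic_Finv => //; lra.
- move=> z /cz[z0 _ tz]; split; first exact: Im_Finv_gt0.
  exact: Hfun_semicircle.
(* On the cone |z| > 1, so |2t/z + t/z^2| <= 3t / |z|. *)
- move=> e e0; exists (3 * t / e) => z /cz[_ Mn _]; rewrite !cabsE => Nz.
  have n0 : 0 < normc z by lra.
  have z0 : z != 0.
    by apply: contraTneq n0 => ->; rewrite ComplexField.Normc.normc0 ltxx.
  have -> : (Finv t z - z) / z = (2 * t)%:C * z^-1 + t%:C * (z^-1 * z^-1).
    by rewrite /Finv; field.
  rewrite (le_lt_trans (le_normcD _ _))//.
  rewrite !ComplexField.Normc.normcM ComplexField.Normc.normcV !normc_real.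
  rewrite !ger0_norm//; last lra.
  have nV : 0 < (normc z)^-1 by rewrite invr_gt0.
  have nV1 : (normc z)^-1 < 1 by rewrite invf_lt1//; lra.
  have : 3 * t * (normc z)^-1 < e.
    by rewrite ltr_pdivrMr// [e * _]mulrC -ltr_pdivrMr.
  move: (_^-1) nV nV1 => v v0 v1 tv; apply: le_lt_trans tv.
  have : t * (v * v) <= t * v by apply: ler_wpM2l => //; nra.
  lra.
Qed.

Lemma free_semigroup_semicircle : free_semigroup (@semicircle R).
Proof.
split; first exact: weakly_continuous_semicircle.
(* This height exceeds s, t and s + t, and the second 1 keeps it above 1 even when s = t = 0. *)
move=> s t s0 t0; exists 1, (1 + s + t + 1), (Finv s), (Finv t), (Finv (s + t)).
split; try by apply: Finv_right_inverse; lra.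
move=> z _; rewrite /Finv mulrDr !rmorphD/=.
by move: (2 * s)%:C (2 * t)%:C s%:C t%:C => a b c d; ring.
Qed.

Lemma semicircle0 (A : set R) : measurable A -> semicircle 0 A = \d_(0 : R) A.
Proof.
move=> mA; rewrite -[LHS]/(angle_law (semicircle_rv 0 @^-1` A)).
have -> : semicircle_rv 0 @^-1` A = [set _ | A 0].
  apply/seteqP; rewrite /semicircle_rv sqrtr0; split=> x /=;
  by rewrite expr0n !mulr0 mul0r addr0.
rewrite diracE; have [A0|A0] := pselect (A 0).
  rewrite mem_set//; have -> : [set _ : measurableTypeR R | A 0] = setT.
    by apply/seteqP; split.
  by rewrite probability_setT.
rewrite memNset//; have -> : [set _ : measurableTypeR R | A 0] = set0.
  by apply/seteqP; split.
by rewrite measure0.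
Qed.

Lemma supp_semicircle1 : supp (@semicircle R 1) `<=` [set x : R | 0 <= x].
Proof.
apply/supp_nonnegP.
rewrite -[LHS]/(angle_law (semicircle_rv 1 @^-1` `]-oo, (0 : R)[%classic)).
have -> : semicircle_rv 1 @^-1` `]-oo, (0 : R)[%classic = set0.
  apply/seteqP; split=> x //=; rewrite in_itv/= /semicircle_rv sqrtr1 expr1n.
  by have := cos_geN1 x; lra.
by rewrite measure0.
Qed.

Lemma supp_semicircle_small :
  ~ (supp (@semicircle R 16^-1) `<=` [set x : R | 0 <= x]).
Proof.
(* Here |z|^2 = 1/10 > 1/16, and [Finv] sends z to a point of real part -29/80. There H takes the
   value z, of larger real part -3/10, against Re H <= Re. *)
move=> /supp_nonnegP m0; pose z : R[i] := (- (3 / 10)) +i* 10^-1.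
have t0 : 0 <= 16^-1 :> R by rewrite invr_ge0.
have nz : normc z ^+ 2 = 10^-1 by rewrite normc_sqr /=; field.
have z0 : 0 < complex.Im z by rewrite /= invr_gt0.
have tz : 16^-1 < normc z ^+ 2 by rewrite nz; lra.
have := Hfun_semicircle t0 z0 tz; have := Re_Finv 16^-1 z.
have := Im_Finv_gt0 t0 z0 tz; case: (Finv _ _) => a b /= b0.
rewrite nz => aE hz.
have a0 : a < 0 by rewrite aE; lra.
by have := Re_Hfun_le m0 a0 b0; rewrite hz /= aE; lra.
Qed.

End free_semigroup.

Theorem theorem10p2 (R : realType) :
  (forall (mu : R -> probability R R) (gamma : R)
          (tau : {finite_measure set R -> \bar R}),
     boolean_semigroup mu ->
     (forall A : set R, measurable A -> mu 0 A = \d_(0 : R) A) ->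
     (forall z : R[i], 0 < complex.Im z ->
        Kfun (mu 1) z
        = gamma%:C - cint tau (fun x => (1 + x%:C * z) / (x%:C - z))) ->
     ((exists t0 : R, 0 < t0 /\ supp (mu t0) `<=` [set x : R | 0 <= x])
      <-> (forall t : R, 0 <= t -> supp (mu t) `<=` [set x : R | 0 <= x]))
     /\
     ((forall t : R, 0 <= t -> supp (mu t) `<=` [set x : R | 0 <= x])
      <-> [/\ supp tau `<=` [set x : R | 0 <= x],
              tau [set 0] = 0%E,
              (\int[tau]_(x in [set x : R | (0 < x)%R]) ((x^-1)%R)%:E < +oo)%E &
              (\int[tau]_(x in [set x : R | (0 < x)%R]) ((x^-1)%R)%:E <= gamma%:E)%E]))
  /\
  (exists mu : R -> probability R R,
     [/\ free_semigroup mu,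
         (forall A : set R, measurable A -> mu 0 A = \d_(0 : R) A),
         (exists t0 : R, 0 < t0 /\ supp (mu t0) `<=` [set x : R | 0 <= x]) &
         (exists t : R, 0 < t /\ ~ (supp (mu t) `<=` [set x : R | 0 <= x]))]).
Proof.
split; first by move=> mu gamma tau bs _; exact: boolean_semigroup_supp.
exists (@semicircle R); split.
- exact: free_semigroup_semicircle.
- exact: semicircle0.
- by exists 1; split=> //; exact: supp_semicircle1.
- by exists 16^-1; split; [rewrite invr_gt0|exact: supp_semicircle_small].
Qed.
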